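(* Let $E$ be a complex Banach lattice which is monotonically complete and has the Fatou property. Let $T$ be a positive and contractive (i.e., $\|T\| \le 1$) linear operator on $E$. If $\lambda \in \mathbb{C}$ is a root of unity and an eigenvalue of $T$, then $\lambda^k$ is also an eigenvalue of $T$ for each $k \in \mathbb{Z}$; even more, for each $k \in \mathbb{Z}$ one has the dimension estimate $$\dim \ker(\lambda - T) \le \dim \ker(\lambda^k - T)$$ for the corresponding eigenspaces, where different infinite cardinalities are not distinguished, i.e., the dimension is understood to be either an integer or $\infty$.
   Context: A complex Banach lattice $E$ is the Banach lattice complexification of a real Banach lattice $E_{\mathbb{R}}$, called the real part of $E$. The order on $E$ is that of its real part, $E_+$ denotes the positive cone, and suprema are taken in the real part of $E$. A linear operator on $E$ is positive if it maps $E_+$ into $E_+$. Here $\lambda - T$ stands for $\lambda\,\mathrm{id}_E - T$. Fatou property: $E$ has the Fatou property if every increasing net $(x_j)_{j\in J} \subseteq E_+$ which possesses a supremum $x \in E$ satisfies $\|x\| = \sup_{j \in J} \|x_j\|$. Monotonically complete: $E$ is monotonically complete if every norm bounded increasing net in $E_+$ has a supremum in $E$ (equivalently, every norm bounded increasing net in the real part of $E$ has a supremum). *)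

(* Defs.v *)
From HB Require Import structures.
From mathcomp Require Import all_boot all_order all_algebra.
From mathcomp Require Import all_classical all_reals all_analysis.
From mathcomp Require Import complex.

Set Implicit Arguments.
Unset Strict Implicit.
Unset Printing Implicit Defensive.

Import Order.TTheory GRing.Theory Num.Theory.
Import numFieldNormedType.Exports.

Local Open Scope classical_set_scope.
Local Open Scope ring_scope.

(* The order is carried by plain operations here and turned into the
   [latticeType] instance below, because Hierarchy Builder rejects a structure
   inheriting from both [CompleteNormedModule] and [Order.Lattice]: those have
   ancestors (normed Z-modules and preorders) whose join was never declared
   before [Num.NumDomain], which inherits from both.
   In [lat_norm], [lat_join x (- x)] is the lattice modulus of [x], whereas
   [`|x|] is its norm. *)
HB.mixin Record isBanachLattice (R : realType) E
    of CompleteNormedModule R E := {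
  lat_le : rel E ;
  lat_join : E -> E -> E ;
  lat_meet : E -> E -> E ;
  lat_le_refl : reflexive lat_le ;
  lat_le_anti : antisymmetric lat_le ;
  lat_le_trans : transitive lat_le ;
  lat_joinP : forall x y z,
    lat_le (lat_join x y) z = lat_le x z && lat_le y z ;
  lat_meetP : forall x y z,
    lat_le x (lat_meet y z) = lat_le x y && lat_le x z ;
  lat_leD : forall x y z, lat_le x y -> lat_le (x + z) (y + z) ;
  lat_leZ : forall (a : R) x y,
    0 <= a -> lat_le x y -> lat_le (a *: x) (a *: y) ;
  lat_norm : forall x y : E,
    lat_le (lat_join x (- x)) (lat_join y (- y)) -> `|x| <= `|y|
}.

#[short(type="banachLatticeType")]
HB.structure Definition BanachLattice (R : realType) :=
  { E of CompleteNormedModule R E & isBanachLattice R E }.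

Section LatticeOrder.
Context {R : realType} (E : banachLatticeType R).

HB.instance Definition _ := Order.Le_isPOrder.Build ring_display
  (BanachLattice.sort E)
  (@lat_le_refl R E) (@lat_le_anti R E) (@lat_le_trans R E).
HB.instance Definition _ := Order.POrder_isJoinSemilattice.Build ring_display
  (BanachLattice.sort E) (@lat_joinP R E).
HB.instance Definition _ := Order.POrder_isMeetSemilattice.Build ring_display
  (BanachLattice.sort E) (@lat_meetP R E).

End LatticeOrder.

Section Nets.
Context {R : realType} (E : banachLatticeType R).

Definition directed_preorder (J : Type) (leJ : J -> J -> Prop) :=
  [/\ inhabited J,
      forall i, leJ i i,
      forall i j k, leJ i j -> leJ j k -> leJ i k &
      forall i j, exists k, leJ i k /\ leJ j k].

Definition increasing_positive_net (J : Type) (leJ : J -> J -> Prop)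
    (x : J -> E) :=
  [/\ directed_preorder leJ,
      forall i j, leJ i j -> x i <= x j &
      forall j, 0 <= x j].

(* The norms [`|x j|] below are bounded by [`|s|], so the real [sup] is the
   genuine supremum. *)
Definition fatou_property :=
  forall (J : Type) (leJ : J -> J -> Prop) (x : J -> E) (s : E),
    increasing_positive_net leJ x -> supremums (range x) s ->
    `|s| = sup (range (fun j => `|x j|)).

Definition monotonically_complete :=
  forall (J : Type) (leJ : J -> J -> Prop) (x : J -> E),
    increasing_positive_net leJ x -> (exists M : R, forall j, `|x j| <= M) ->
    exists s, supremums (range x) s.

End Nets.

(* The pair [(x, y)] stands for [x + i y]. *)
Definition complexification {R : realType} (E : banachLatticeType R) : Type :=
  (E * E)%type.

Section Complexification.
Context {R : realType} (E : banachLatticeType R).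
Local Notation EC := (complexification E).

HB.instance Definition _ := GRing.Zmodule.copy EC (E * E)%type.

Definition scaleEC (c : R[i]) (z : EC) : EC :=
  (complex.Re c *: z.1 - complex.Im c *: z.2,
   complex.Re c *: z.2 + complex.Im c *: z.1).

Fact scaleECA a b z : scaleEC a (scaleEC b z) = scaleEC (a * b) z.
Proof.
case: a b z => [a1 a2] [b1 b2] [x y]; rewrite /scaleEC /=; congr (_, _).
- rewrite !(scalerBr, scalerDr, scalerBl, scalerDl) !scalerA !opprD -!addrA.
  by congr (_ + _); rewrite addrA addrC.
- rewrite !(scalerBr, scalerDr, scalerBl, scalerDl) !scalerA -!addrA.
  by congr (_ + _); rewrite addrA addrC.
Qed.

Fact scaleEC1 : left_id 1 scaleEC.
Proof. by move=> [x y]; rewrite /scaleEC /= !scale1r !scale0r subr0 addr0. Qed.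

Fact scaleECDr : right_distributive scaleEC +%R.
Proof.
move=> [a1 a2] [x1 y1] [x2 y2]; rewrite /scaleEC /=; congr (_, _).
- by rewrite !scalerDr opprD addrACA.
- by rewrite !scalerDr addrACA.
Qed.

Fact scaleECDl z : {morph scaleEC^~ z : a b / a + b}.
Proof.
move=> [a1 a2] [b1 b2]; case: z => [x y]; rewrite /scaleEC /=; congr (_, _).
- by rewrite !scalerDl opprD addrACA.
- by rewrite !scalerDl addrACA.
Qed.

HB.instance Definition _ :=
  GRing.Zmodule_isLmodule.Build R[i] EC scaleECA scaleEC1 scaleECDr scaleECDl.

(* [|x + i y| = sup_t (cos t x + sin t y)], the supremum being taken in [E].
   It exists because [E] is norm complete, so that the default value [0] of
   [supremum] plays no role. *)
Definition cmodulus (z : EC) : E :=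
  supremum 0 (range (fun t : R => cos t *: z.1 + sin t *: z.2)).

Definition cnorm (z : EC) : R := `|cmodulus z|.

Definition cpositive (z : EC) : Prop := 0 <= z.1 /\ z.2 = 0.

Definition positive_operator (T : EC -> EC) :=
  forall z, cpositive z -> cpositive (T z).

Definition contractive (T : EC -> EC) := forall z, cnorm (T z) <= cnorm z.

End Complexification.

Section Spectral.
Context {R : realType} {V : lmodType R[i]}.

Definition is_basis (W : set V) (n : nat) (v : 'I_n -> V) :=
  [/\ forall i, W (v i),
      forall c : 'I_n -> R[i], \sum_i c i *: v i = 0 -> forall i, c i = 0 &
      forall w, W w -> exists c : 'I_n -> R[i], w = \sum_i c i *: v i].

(* The common length of all finite bases of the subspace [W], and [+oo] if
   there is no finite basis. *)
Definition dimension (W : set V) : \bar R :=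
  xget +oo%E [set n%:R%:E | n in [set n | exists v : 'I_n -> V, is_basis W v]].

Definition ker_sub (l : R[i]) (T : V -> V) : set V :=
  [set z | l *: z - T z = 0].

Definition is_eigenvalue (T : V -> V) (l : R[i]) :=
  exists2 z, z != 0 & T z = l *: z.

End Spectral.

(* Main.v *)
(* Let d be the order of lambda and S = T^d. If S w >= w >= 0, iterating S
   transfinitely from w (suprema exist by monotone completeness, norms stay
   bounded by the Fatou property) reaches a least S-fixed point above w. Hence
   F = Fix(S) is a vector lattice for the order of E, although in general not a
   sublattice of E, and T acts on F as a lattice automorphism with T^d = id.
   All eigenvectors for lambda live in the complexification of F.

   For such an eigenvector z <> 0, the set where Re(w z) exceeds all the other
   Re(lambda^i w z) is a sector that T moves through d disjoint positions; for a
   suitable w it gives some h > 0 in F with h, T h, ..., T^(d-1) h disjoint.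
   If such "wandering" elements exist only in families of bounded size, the
   members of a maximal family are atoms, and an eigenvector is determined by
   its coefficients on these atoms. So n independent eigenvectors for lambda
   yield n wandering elements h_j with disjoint orbits, and the sums over i < d
   of lambda^(-ki) T^i h_j are n independent eigenvectors for lambda^k. *)
From HB Require Import structures.
Require Import Defs.
From mathcomp Require Import all_boot all_order all_algebra.
From mathcomp Require Import all_classical all_reals all_analysis.
From mathcomp Require Import complex ring lra.
Set Implicit Arguments.
Unset Strict Implicit.
Unset Printing Implicit Defensive.

Import Order.TTheory GRing.Theory Num.Theory.
Local Open Scope ring_scope.

(** * Archimedean Riesz spaces *)

HB.mixin Record isRiesz (R : realType) V of GRing.Lmodule R V := {
  riesz_le : rel V ;
  riesz_join : V -> V -> V ;
  riesz_meet : V -> V -> V ;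
  riesz_le_refl : reflexive riesz_le ;
  riesz_le_anti : antisymmetric riesz_le ;
  riesz_le_trans : transitive riesz_le ;
  riesz_joinP : forall x y z,
    riesz_le (riesz_join x y) z = riesz_le x z && riesz_le y z ;
  riesz_meetP : forall x y z,
    riesz_le x (riesz_meet y z) = riesz_le x y && riesz_le x z ;
  riesz_leD : forall x y z, riesz_le x y -> riesz_le (x + z) (y + z) ;
  riesz_leZ : forall (a : R) x y,
    0 <= a -> riesz_le x y -> riesz_le (a *: x) (a *: y) ;
  riesz_archimedean : forall x y,
    (forall n : nat, riesz_le (x *+ n) y) -> riesz_le x 0
}.

#[short(type="rieszType")]
HB.structure Definition Riesz (R : realType) :=
  { V of GRing.Lmodule R V & isRiesz R V }.

Fact riesz_display : Order.disp_t. Proof. exact: Order.Disp tt tt. Qed.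

Section RieszOrder.
Context {R : realType} (V : rieszType R).

HB.instance Definition _ := Order.Le_isPOrder.Build riesz_display
  (Riesz.sort V)
  (@riesz_le_refl R V) (@riesz_le_anti R V) (@riesz_le_trans R V).
HB.instance Definition _ := Order.POrder_isJoinSemilattice.Build riesz_display
  (Riesz.sort V) (@riesz_joinP R V).

HB.instance Definition _ := Order.POrder_isMeetSemilattice.Build riesz_display
  (Riesz.sort V) (@riesz_meetP R V).

End RieszOrder.

(* The Riesz structure is explicit: left to inference, the type of [x + y] would
   select the ordered group structures attached to [+]. *)
Notation "x <=v y" :=
  (@Order.le riesz_display (Riesz_sort__canonical__Order_Preorder _) x y)
  (at level 70, y at next level) : ring_scope.
Notation "x <v y" :=
  (@Order.lt riesz_display (Riesz_sort__canonical__Order_Preorder _) x y)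
  (at level 70, y at next level) : ring_scope.
Notation "x `|` y" :=
  (@Order.join riesz_display (Riesz_sort__canonical__Order_JoinSemilattice _) x y)
  : ring_scope.
Notation "x `&` y" :=
  (@Order.meet riesz_display (Riesz_sort__canonical__Order_MeetSemilattice _) x y)
  : ring_scope.

Section RieszTheory.
Context {R : realType} {V : rieszType R}.
Implicit Types (x y z u v w f g : V) (a b c : R).
Lemma rz_leD2r z x y : (x + z <=v y + z) = (x <=v y).
Proof.
apply/idP/idP => [|]; last exact: riesz_leD.
by move=> /(@riesz_leD _ _ _ _ (- z)); rewrite !addrK.
Qed.

Lemma rz_leD2l z x y : (z + x <=v z + y) = (x <=v y).
Proof. by rewrite ![z + _]addrC rz_leD2r. Qed.

Lemma rz_leD x y z w : x <=v y -> z <=v w -> x + z <=v y + w.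
Proof. by move=> xy zw; rewrite (le_trans (y := y + z)) ?rz_leD2r ?rz_leD2l. Qed.

Lemma rz_subr_ge0 x y : (0 <=v y - x) = (x <=v y).
Proof. by rewrite -(rz_leD2r x) add0r subrK. Qed.

Lemma rz_lerBlDr x y z : (x - y <=v z) = (x <=v z + y).
Proof. by rewrite -(rz_leD2r y) subrK. Qed.

Lemma rz_lerBlDl x y z : (x - y <=v z) = (x <=v y + z).
Proof. by rewrite rz_lerBlDr addrC. Qed.

Lemma rz_lerBrDr x y z : (x <=v y - z) = (x + z <=v y).
Proof. by rewrite -(rz_leD2r z) subrK. Qed.

Lemma rz_leN x y : (- x <=v - y) = (y <=v x).
Proof. by rewrite -(rz_leD2r (x + y)) addKr addrCA addNr addr0. Qed.

Lemma rz_addr_ge0 x y : 0 <=v x -> 0 <=v y -> 0 <=v x + y.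
Proof. by move=> x0 y0; rewrite -[0]addr0 rz_leD. Qed.

Lemma rz_sum_ge0 (I : Type) (r : seq I) (P : pred I) (F : I -> V) :
  (forall i, P i -> 0 <=v F i) -> 0 <=v \sum_(i <- r | P i) F i.
Proof. by move=> F0; elim/big_ind: _ => //; exact: rz_addr_ge0. Qed.

Lemma rz_leZ a x y : 0 <= a -> x <=v y -> a *: x <=v a *: y.
Proof. exact: riesz_leZ. Qed.

Lemma rz_leZ2 a x y : 0 < a -> (a *: x <=v a *: y) = (x <=v y).
Proof.
move=> a0; apply/idP/idP => [|]; last by apply: rz_leZ; exact: ltW.
have a'0 : 0 <= a^-1 by rewrite invr_ge0 ltW.
by move=> /(rz_leZ a'0); rewrite !scalerA mulVf ?gt_eqF// !scale1r.
Qed.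

Lemma rz_scale_ge0 a x : 0 <= a -> 0 <=v x -> 0 <=v a *: x.
Proof. by move=> a0 x0; rewrite -(scaler0 V a) rz_leZ. Qed.

Lemma rz_leZl a b x : 0 <=v x -> a <= b -> a *: x <=v b *: x.
Proof.
by move=> x0 ab; rewrite -rz_subr_ge0 -scalerBl rz_scale_ge0 ?subr_ge0.
Qed.

Lemma rz_joinDr x y z : (x `|` y) + z = (x + z) `|` (y + z).
Proof.
apply: le_anti; rewrite leUx !rz_leD2r leUl leUr andbT.
by rewrite -rz_lerBrDr leUx !rz_lerBrDr leUl leUr.
Qed.

Lemma rz_meetDr x y z : (x `&` y) + z = (x + z) `&` (y + z).
Proof.
apply: le_anti; rewrite lexI !rz_leD2r leIl leIr andTb.
by rewrite -rz_lerBlDr lexI !rz_lerBlDr leIl leIr.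
Qed.

Lemma rz_oppU x y : - (x `|` y) = (- x) `&` (- y).
Proof.
apply: le_anti; rewrite lexI !rz_leN leUl leUr andTb.
set m := _ `&` _; rewrite -[leLHS](opprK m) rz_leN leUx.
by rewrite -(rz_leN (- m) x) -(rz_leN (- m) y) opprK leIl leIr.
Qed.

Lemma rz_meetZ a x y : 0 <= a -> a *: (x `&` y) = (a *: x) `&` (a *: y).
Proof.
rewrite le_eqVlt => /predU1P[<-|a0]; first by rewrite !scale0r meetxx.
apply: le_anti; rewrite lexI !rz_leZ2// leIl leIr andTb.
rewrite -(@rz_leZ2 a^-1) ?invr_gt0// scalerA mulVf ?gt_eqF// scale1r lexI.
by rewrite -(@rz_leZ2 a _ x a0) -(@rz_leZ2 a _ y a0) !scalerA mulfV ?gt_eqF// !scale1r leIl leIr.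
Qed.

Lemma rz_meet_ge0 x y : 0 <=v x -> 0 <=v y -> 0 <=v x `&` y.
Proof. by rewrite lexI => -> ->. Qed.

Lemma rz_meet_le u x y : 0 <=v u -> 0 <=v x -> x <=v y -> u `&` y = 0 -> u `&` x = 0.
Proof.
move=> u0 x0 xy uy; apply/le_anti/andP; split; last exact: rz_meet_ge0.
by rewrite -uy leI2.
Qed.

(** Subtracting the meet of [u] and [x] from the left side leaves an element below both [u] and [y].
    This subadditivity makes the elements disjoint from [u] closed under sums. *)
Lemma rz_meetD u x y : 0 <=v u -> 0 <=v x -> 0 <=v y ->
  u `&` (x + y) <=v u `&` x + u `&` y.
Proof.
move=> u0 x0 y0; rewrite -rz_lerBlDl lexI; apply/andP; split; last first.
  rewrite rz_lerBlDl -rz_lerBlDr lexI !rz_lerBlDr leIr andbT.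
  by rewrite (le_trans (leIl _ _))// -[leLHS]addr0 rz_leD2l.
rewrite rz_lerBlDl (le_trans (leIl _ _))// -[leLHS]add0r rz_leD2r.
exact: rz_meet_ge0.
Qed.

Lemma rz_archimedean x y : (forall n : nat, x *+ n <=v y) -> x <=v 0.
Proof. exact: riesz_archimedean. Qed.

Lemma rz_le_eps x y : 0 <=v y -> (forall e, 0 < e -> x <=v e *: y) -> x <=v 0.
Proof.
move=> y0 xy; apply: (@rz_archimedean _ y) => -[|n]; first by rewrite mulr0n.
rewrite -scaler_nat -(@rz_leZ2 n.+1%:R^-1) ?invr_gt0// scalerA.
by rewrite mulVf// scale1r xy// invr_gt0.
Qed.

Definition rpos f : V := f `|` 0.
Definition rabs f : V := rpos f + rpos (- f).

Lemma rpos_ge0 f : 0 <=v rpos f. Proof. exact: leUr. Qed.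
Lemma rpos_ge f : f <=v rpos f. Proof. exact: leUl. Qed.
Hint Resolve rpos_ge0 rpos_ge : core.

Lemma rpos_le f g : f <=v g -> rpos f <=v rpos g.
Proof. by move=> fg; rewrite leUx rpos_ge0 (le_trans fg). Qed.

Lemma rpos_id f : 0 <=v f -> rpos f = f.
Proof. by move=> f0; exact: join_l. Qed.

Lemma rpos_npos f : f <=v 0 -> rpos f = 0.
Proof. by move=> f0; exact: join_r. Qed.

Lemma rposB f : rpos f - rpos (- f) = f.
Proof.
apply/eqP; rewrite subr_eq; apply/eqP.
by rewrite addrC rz_joinDr addNr add0r joinC.
Qed.

(** The meet of [f] and [0] is [- rpos (- f)]; translating both entries by [rpos (- f)] gives the
    claim. *)
Lemma rpos_disj f : rpos f `&` rpos (- f) = 0.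
Proof.
have : (rpos f - rpos (- f)) `&` (rpos (- f) - rpos (- f)) = - rpos (- f).
  by rewrite rposB subrr rz_oppU opprK oppr0.
by rewrite -rz_meetDr => /eqP; rewrite subr_eq addNr => /eqP.
Qed.

Lemma rposD f g : rpos (f + g) <=v rpos f + rpos g.
Proof. by rewrite leUx rz_addr_ge0// rz_leD. Qed.

Lemma rposZ a f : 0 <= a -> rpos (a *: f) = a *: rpos f.
Proof.
move=> a0; apply: oppr_inj.
by rewrite -scalerN !rz_oppU rz_meetZ// oppr0 scaler0 scalerN.
Qed.

Lemma rabs_ge0 f : 0 <=v rabs f. Proof. by rewrite rz_addr_ge0. Qed.
Hint Resolve rabs_ge0 : core.

Lemma rabsN f : rabs (- f) = rabs f.
Proof. by rewrite /rabs opprK addrC. Qed.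

Lemma rpos_le_rabs f : rpos f <=v rabs f.
Proof. by rewrite -[leLHS]addr0 rz_leD2l. Qed.

Lemma rabs_ge f : f <=v rabs f.
Proof. exact: le_trans (rpos_ge f) (rpos_le_rabs f). Qed.

Lemma rabs_id f : 0 <=v f -> rabs f = f.
Proof.
by move=> f0; rewrite /rabs rpos_id// rpos_npos ?addr0// -rz_leN opprK oppr0.
Qed.

Lemma rabsD f g : rabs (f + g) <=v rabs f + rabs g.
Proof. by rewrite addrACA rz_leD// ?opprD rposD. Qed.

Lemma rabsZ a f : rabs (a *: f) = `|a| *: rabs f.
Proof.
have pZ b : 0 <= b -> rabs (b *: f) = b *: rabs f.
  by move=> b0; rewrite /rabs -scalerN !rposZ// scalerDr.
have [a0|a0] := ger0P a; first exact: pZ.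
by rewrite -[LHS]rabsN -scaleNr pZ// oppr_ge0 ltW.
Qed.

Lemma rabs_eq0 f : rabs f = 0 -> f = 0.
Proof.
move=> f0; apply/le_anti; rewrite -{1}f0 rabs_ge/=.
by rewrite -rz_leN oppr0 -f0 -rabsN rabs_ge.
Qed.

(** Disjointness, meant for [u >= 0]. Only [f] passes through [rabs], so that for a fixed positive
    [u] the elements [f] form a linear subspace, to be read as those vanishing on [u]. *)
Definition orth u f := u `&` rabs f = 0.

Lemma orthP u f : 0 <=v f -> orth u f <-> u `&` f = 0.
Proof. by move=> f0; rewrite /orth rabs_id. Qed.

Lemma orth0 u : 0 <=v u -> orth u 0.
Proof. by move=> u0; rewrite orthP//; exact: meet_r. Qed.

Lemma orth_le u f g : 0 <=v u -> rabs f <=v rabs g -> orth u g -> orth u f.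
Proof. by move=> u0; exact: rz_meet_le. Qed.

Lemma orth_le_pos u f g : 0 <=v u -> 0 <=v f -> f <=v g -> orth u g -> orth u f.
Proof.
by move=> u0 f0 fg; apply: orth_le => //; rewrite !rabs_id// (le_trans f0).
Qed.

Lemma orth_sub u w f : 0 <=v w -> w <=v u -> orth u f -> orth w f.
Proof.
move=> w0 wu uf; apply/le_anti; rewrite rz_meet_ge0// andbT -uf.
by rewrite leI2.
Qed.

Lemma orthN u f : orth u f -> orth u (- f).
Proof. by rewrite /orth rabsN. Qed.

Lemma orthD u f g : 0 <=v u -> orth u f -> orth u g -> orth u (f + g).
Proof.
move=> u0 uf ug; apply/le_anti; rewrite rz_meet_ge0// andbT.
apply: (@le_trans _ _ (u `&` (rabs f + rabs g))); first by rewrite leI2// rabsD.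
by rewrite (le_trans (rz_meetD _ _ _))// uf ug addr0.
Qed.

Lemma orthZ u a f : 0 <=v u -> orth u f -> orth u (a *: f).
Proof.
move=> u0 uf; apply/le_anti; rewrite rz_meet_ge0// andbT rabsZ.
(* The factor |a| + 1 dominates both 1 and |a|, so scaling by it enlarges both entries of the meet
   at once. *)
have a1 : 1 <= `|a| + 1 by rewrite lerDr.
have a0 : 0 <= `|a| + 1 by rewrite (le_trans _ a1).
apply: (@le_trans _ _ ((`|a| + 1) *: (u `&` rabs f))); last first.
  by rewrite uf scaler0.
rewrite rz_meetZ// leI2//; last by rewrite rz_leZl// lerDl.
by rewrite -[leLHS]scale1r rz_leZl.
Qed.

Lemma orthB u f g : 0 <=v u -> orth u f -> orth u g -> orth u (f - g).
Proof. by move=> u0 uf ug; apply: orthD => //; apply: orthN. Qed.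

Lemma orth_sum (I : Type) (r : seq I) (P : pred I) (F : I -> V) u :
  0 <=v u -> (forall i, P i -> orth u (F i)) -> orth u (\sum_(i <- r | P i) F i).
Proof.
by move=> u0 uF; elim/big_ind: _ => //; [exact: orth0|move=> *; exact: orthD].
Qed.

Lemma orth_pos_neg u f :
  0 <=v u -> orth u (rpos f) -> orth u (rpos (- f)) -> orth u f.
Proof. by move=> u0 fp fn; rewrite -(rposB f); exact: orthB. Qed.

Lemma orth_rabs u f : orth u f -> orth u (rabs f).
Proof. by rewrite /orth (rabs_id (rabs_ge0 f)). Qed.

Lemma orth_sym u v : 0 <=v u -> 0 <=v v -> orth u v -> orth v u.
Proof. by move=> u0 v0; rewrite !orthP// meetC. Qed.

Lemma orth_self u : 0 <=v u -> orth u u -> u = 0.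
Proof. by move=> u0; rewrite orthP// meetxx. Qed.

Lemma orth_le_eq0 u v : 0 <=v u -> u <=v v -> orth u v -> u = 0.
Proof. by move=> u0 uv /(orth_le_pos u0 u0 uv); exact: orth_self. Qed.

(* Replaces the choice of a prime ideal: below any [u > 0] one of two disjoint
   elements can be made to vanish. *)
Lemma orth_split u v w : 0 <v u -> 0 <=v v -> 0 <=v w -> orth v w ->
  exists2 u', 0 <v u' /\ u' <=v u & orth u' v \/ orth u' w.
Proof.
move=> u0 v0 w0 vw; have [uv|uv] := eqVneq (u `&` v) 0.
  by exists u; [split|left; rewrite orthP].
exists (u `&` v).
  by split; rewrite ?leIl// lt_def uv rz_meet_ge0// ltW.
by right; apply: orth_sub vw; rewrite ?leIr// rz_meet_ge0// ltW.
Qed.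

End RieszTheory.

#[local] Hint Resolve rpos_ge0 rabs_ge0 : core.

(** * Coefficients on an atom of an Archimedean Riesz space *)

Section Atoms.
Context {R : realType} {V : rieszType R}.
Implicit Types (f g h u v : V).

(** Since [rpos g] is at most [rpos (g - e *: h) + e *: h], its meet with [h] is at most [e *: h]
    for every [e > 0], and the Archimedean property applies. *)
Lemma orth_rpos_approx h g : 0 <=v h ->
  (forall e, 0 < e -> orth h (rpos (g - e *: h))) -> orth h (rpos g).
Proof.
move=> h0 gh; rewrite orthP//; apply/le_anti; rewrite rz_meet_ge0// andbT.
apply: (rz_le_eps h0) => e e0.
have eh0 : 0 <=v e *: h by rewrite rz_scale_ge0// ltW.
have gle : rpos g <=v rpos (g - e *: h) + e *: h.
  rewrite leUx rz_addr_ge0// andbT -rz_lerBlDr.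
  exact: rpos_ge.
apply: (@le_trans _ _ (h `&` (rpos (g - e *: h) + e *: h))); first by rewrite leI2.
apply: (le_trans (rz_meetD h0 _ eh0)) => //.
have /orthP -> // := gh _ e0.
by rewrite add0r leIr.
Qed.

(** Otherwise the positive part of [n h - rpos g] is disjoint from [h] and at the same time below
    [n h], hence zero. Then all multiples of [h] lie below [rpos g], against the Archimedean
    property. *)
Lemma exists_not_orth h g : 0 <v h -> exists t : R, ~ orth h (rpos (t *: h - g)).
Proof.
move=> h0; have hge := ltW h0; apply: contrapT => no.
have hn (n : nat) : h *+ n <=v rpos g.
  have o : orth h (rpos (n%:R *: h - rpos g)).
    have : orth h (rpos (n%:R *: h - g)).
      by apply: contrapT => o; apply: no; exists n%:R.
    by apply: orth_le_pos => //; apply: rpos_le; rewrite rz_leD2l rz_leN rpos_ge.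
  have nh0 : 0 <=v n%:R *: h by rewrite rz_scale_ge0.
  have w0 : rpos (n%:R *: h - rpos g) = 0.
    apply: (@orth_le_eq0 _ _ _ (n%:R *: h)) => //.
      by rewrite leUx nh0 andbT rz_lerBlDr -[leLHS]addr0 rz_leD2l.
    by apply: orthZ => //; apply: orth_sym.
  rewrite -scaler_nat -rz_subr_ge0 -rz_leN oppr0 opprB -w0.
  exact: rpos_ge.
by have /le_lt_trans/(_ h0) := rz_archimedean hn; rewrite ltxx.
Qed.

(** A Dedekind cut: as [h] has no two disjoint parts, for each [t] either [t h <= f] or [f <= t h]
    holds on [h]. The coefficient is the supremum of the [t] of the first kind; the two estimates
    hold up to every [e > 0], hence exactly. *)
Lemma atom_coef h : 0 <v h ->
  (forall u v, 0 <v u -> 0 <v v -> u <=v h -> v <=v h -> ~ orth u v) ->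
  forall f, exists c : R, orth h (f - c *: h).
Proof.
move=> h0 atom f; have hge := ltW h0.
pose lower t := orth h (rpos (t *: h - f)).
pose A : set R := [set t | lower t]%classic.
pose upper t := orth h (rpos (f - t *: h)).
have total t : lower t \/ upper t.
  rewrite /lower /upper !orthP//.
  have [|u0] := eqVneq (h `&` rpos (t *: h - f)) 0; first by left.
  have [|v0] := eqVneq (h `&` rpos (f - t *: h)) 0; first by right.
  have ge0 g : 0 <=v h `&` rpos g by rewrite rz_meet_ge0.
  exfalso; apply: (atom (h `&` rpos (t *: h - f)) (h `&` rpos (f - t *: h)));
    rewrite ?leIl//.
  - by rewrite lt_def u0 ge0.
  - by rewrite lt_def v0 ge0.
  - apply: (orth_sub _ (leIr _ _)) => //.
    apply: (@orth_le_pos _ _ _ _ (rpos (f - t *: h))); rewrite ?leIr//.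
    by rewrite -[f - _]opprB orthP// rpos_disj.
have lower_le s t : s <= t -> lower t -> lower s.
  move=> st; apply: orth_le_pos => //; apply: rpos_le; rewrite rz_leD2r.
  exact: rz_leZl.
have [t0 t0P] := exists_not_orth f h0.
have ubA : ubound A t0.
  by move=> t /= lt; rewrite leNgt; apply/negP => /ltW/lower_le /(_ lt).
(* Applied to [- f], the same lemma shows that [upper] fails at [- s0], so [- s0] lies in [A]. *)
have [s0 s0P] := exists_not_orth (- f) h0.
have A0 : (A !=set0)%classic.
  exists (- s0) => /=; case: (total (- s0)) => //; rewrite /upper.
  by rewrite scaleNr opprK addrC -[X in _ + X]opprK => /s0P.
have supA : has_sup A by split => //; exists t0.
exists (sup A); set c := sup A.
apply: orth_pos_neg => //; apply: orth_rpos_approx => // e e0.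
  rewrite -addrA -opprD -scalerDl.
  case: (total (c + e)) => // /(ub_le_sup supA.2).
  by rewrite -/c gerDl leNgt e0.
rewrite opprB addrAC -scalerBl.
have [t /= lt ct] := sup_adherent e0 supA.
exact: lower_le (ltW ct) lt.
Qed.

End Atoms.

(** * Roots of unity *)

Section RootsOfUnity.
Context {R : realType}.
Implicit Types (l m w : R[i]).
Local Open Scope complex_scope.

Lemma conjc_unity_root l d : (0 < d)%N -> l ^+ d = 1 -> conjc l = l^-1.
Proof.
move=> d0 ld; have /eqP nl : `|l| == 1.
  by rewrite -(@pexpr_eq1 _ `|l| d)// -normrX ld normr1.
by rewrite invc_norm nl expr1n invr1 mul1r.
Qed.

(* The differences of [d]-th roots of unity take finitely many directions. *)
Lemma unity_root_diff_conj l d i j : (0 < d)%N -> l ^+ d = 1 ->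
  let m : R[i] := l ^+ j * (1 - l ^+ i) in m ^+ (2 * d) = conjc m ^+ (2 * d).
Proof.
move=> d0 ld m; have l0 : l != 0.
  by apply: contra_eq_neq ld => ->; rewrite expr0n gtn_eqF// eq_sym oner_eq0.
have mJ : conjc m = l^-1 ^+ j * (1 - l^-1 ^+ i).
  by rewrite -(conjc_unity_root d0 ld) rmorphM rmorphB rmorph1 !rmorphXn.
have : m = - l ^+ (j + j + i) * (l^-1 ^+ j * (1 - l^-1 ^+ i)).
  rewrite /m !exprD !exprVn; field.
  by rewrite !expf_neq0.
rewrite -mJ => mE; rewrite {1}mE exprMn exprM sqrrN -[X in X * _]exprM.
by rewrite exprAC mulnC exprM ld !expr1n mul1r.
Qed.

(** The quotients of [1 + i n] by its conjugate, for [n] from [0] to [d], are [d + 1] distinct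
    numbers, too many to be all [d]-th roots of unity. *)
Lemma exists_conj_pow_neq d : (0 < d)%N ->
  exists w, w ^+ d != conjc w ^+ d.
Proof.
move=> d0; pose w n : R[i] := 1 +i* n%:R.
have w0 n : conjc (w n) != 0 by rewrite eq_complex /= oner_eq0.
pose rs := [seq w n / conjc (w n) | n <- iota 0 d.+1].
have Urs : uniq rs.
  rewrite map_inj_uniq ?iota_uniq// => n p /eqP.
  rewrite eqr_div// => /eqP[_ /eqP]; rewrite !mul1r !mulr1 => /eqP e.
  by apply/eqP; rewrite -(eqr_nat R); apply/eqP; lra.
apply: contrapT => nw.
have : all d.-unity_root rs.
  apply/allP => _ /mapP[n _ ->]; apply/unity_rootP.
  rewrite expr_div_n; apply/eqP; rewrite -[_ == _]negbK; apply/negP => ne.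
  apply: nw; exists (w n); apply: contra ne => /eqP ->.
  by rewrite divff// expf_neq0.
by move=> /(max_unity_roots d0)/(_ Urs); rewrite size_map size_iota ltnn.
Qed.

(** The hypothesis says that [m] and [w] are parallel over the reals, that is, [conjc m * w] is
    real. *)
Lemma cross_eq0 m w : complex.Re m * complex.Im w = complex.Im m * complex.Re w ->
  conjc m * w = m * conjc w.
Proof.
case: m w => [a b] [c d] /= e; apply/eqP; rewrite eq_complex /=.
by apply/andP; split; apply/eqP; lra.
Qed.

End RootsOfUnity.
(** * Periodic lattice automorphisms *)

Section PeriodicAutomorphism.
Context {R : realType} {V : rieszType R} (tau : {linear V -> V}) (d : nat).
Hypothesis d_gt0 : (0 < d)%N.
Hypothesis tau_ge0 : forall x : V, 0 <=v x -> 0 <=v tau x.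
Hypothesis tau_periodic : forall x, iter d tau x = x.
Implicit Types (x y u v f g h e : V) (i j n r : nat).

Lemma tau_le x y : x <=v y -> tau x <=v tau y.
Proof. by rewrite -rz_subr_ge0 => /tau_ge0; rewrite linearB rz_subr_ge0. Qed.

Lemma iter_tau_le i x y : x <=v y -> iter i tau x <=v iter i tau y.
Proof. by move=> xy; elim: i => //= i; exact: tau_le. Qed.

Lemma iter_tau_ge0 i x : 0 <=v x -> 0 <=v iter i tau x.
Proof. by move=> x0; elim: i => //= i; exact: tau_ge0. Qed.

Lemma iter_predK x : iter d.-1 tau (tau x) = x.
Proof. by rewrite -iterSr prednK// tau_periodic. Qed.

Lemma tau_predK x : tau (iter d.-1 tau x) = x.
Proof. by rewrite -iterS prednK// tau_periodic. Qed.

(** The inverse of [tau] is its power [d - 1], which is positive too, so [tau] is an order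
    isomorphism. *)
Lemma tau_meet x y : tau (x `&` y) = tau x `&` tau y.
Proof.
apply/le_anti; rewrite lexI !tau_le ?leIl ?leIr// andTb.
rewrite -[leLHS]tau_predK tau_le// lexI.
by apply/andP; split; rewrite -[leRHS]iter_predK iter_tau_le ?leIl ?leIr.
Qed.

Lemma tau_rpos x : tau (rpos x) = rpos (tau x).
Proof.
have rposE f : rpos f = - ((- f) `&` 0) by rewrite -oppr0 -rz_oppU opprK.
by rewrite !rposE linearN tau_meet linearN linear0.
Qed.

Lemma tau_rabs x : tau (rabs x) = rabs (tau x).
Proof. by rewrite linearD !tau_rpos linearN. Qed.

Lemma iter_tau_rabs i x : iter i tau (rabs x) = rabs (iter i tau x).
Proof. by elim: i => //= i ->; exact: tau_rabs. Qed.

Lemma orth_iter i u f : orth u f -> orth (iter i tau u) (iter i tau f).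
Proof.
move=> uf; elim: i => //= i; rewrite /orth -tau_rabs -tau_meet => ->.
by rewrite linear0.
Qed.

Lemma iter_tau0 i : iter i tau 0 = 0.
Proof. by elim: i => //= i ->; rewrite linear0. Qed.

Lemma iter_tau_gt0 i x : 0 <v x -> 0 <v iter i tau x.
Proof.
move=> x0; elim: i => //= i; rewrite !lt_def => /andP[n0 ge].
rewrite tau_ge0// andbT; apply: contra n0 => /eqP t0.
by rewrite -(iter_predK (iter i tau x)) t0 iter_tau0.
Qed.

Definition orbit_sum h : V := \sum_(i < d) iter i tau h.

Lemma orbit_sum_ge0 h : 0 <=v h -> 0 <=v orbit_sum h.
Proof. by move=> h0; apply: rz_sum_ge0 => i _; exact: iter_tau_ge0. Qed.

Lemma tau_orbit_sum h : tau (orbit_sum h) = orbit_sum h.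
Proof.
rewrite /orbit_sum linear_sum; case: d d_gt0 tau_periodic => // d' _ td.
rewrite big_ord_recr [RHS]big_ord_recl /= [RHS]addrC; congr (_ + _).
exact: td.
Qed.

Lemma iter_orbit_sum i h : iter i tau (orbit_sum h) = orbit_sum h.
Proof. by elim: i => //= i ->; exact: tau_orbit_sum. Qed.

Lemma le_orbit_sum h : 0 <=v h -> h <=v orbit_sum h.
Proof.
move=> h0; rewrite /orbit_sum; case: d d_gt0 => // d' _.
rewrite big_ord_recl -[leLHS]addr0 rz_leD2l.
by apply: rz_sum_ge0 => i _; exact: iter_tau_ge0.
Qed.

Lemma iter_le_orbit_sum i h : 0 <=v h -> iter i tau h <=v orbit_sum h.
Proof.
by move=> h0; rewrite -(iter_orbit_sum i) iter_tau_le// le_orbit_sum.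
Qed.

Lemma orbit_sum_mono g h : g <=v h -> orbit_sum g <=v orbit_sum h.
Proof.
move=> gh; rewrite -rz_subr_ge0 /orbit_sum -sumrB; apply: rz_sum_ge0 => i _.
by rewrite rz_subr_ge0 iter_tau_le.
Qed.

(** As [orbit_sum v] is invariant, disjointness from it passes from [u] to all translates of [u]. *)
Lemma orth_orbit_sum u v : 0 <=v u -> 0 <=v v ->
  (forall i, (i < d)%N -> orth u (iter i tau v)) ->
  orth (orbit_sum u) (orbit_sum v).
Proof.
move=> u0 v0 uv.
have uO : orth u (orbit_sum v) by apply: orth_sum => // i _; exact: uv.
apply: orth_sym; rewrite ?orbit_sum_ge0//.
apply: orth_sum => [|i _]; first exact: orbit_sum_ge0.
apply: orth_sym; rewrite ?iter_tau_ge0 ?orbit_sum_ge0//.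
by rewrite -(iter_orbit_sum i v); exact: orth_iter.
Qed.

(* An element whose orbit consists of [d] disjoint elements: the indicator of
   a small set that the dynamics moves off itself. *)
Definition wandering h :=
  0 <v h /\ forall i, (0 < i < d)%N -> orth h (iter i tau h).

Lemma wandering_sub g h : 0 <v g -> g <=v h -> wandering h -> wandering g.
Proof.
move=> g0 gh [h0 hd]; split => // i id.
apply: (orth_sub (ltW g0) gh).
apply: (@orth_le_pos _ _ _ _ (iter i tau h)); rewrite ?iter_tau_ge0 ?(ltW g0)//.
- exact: ltW.
- exact: iter_tau_le.
- exact: hd.
Qed.

Lemma wandering_orth h i j : wandering h -> (i < d)%N -> (j < d)%N -> i != j ->
  orth (iter i tau h) (iter j tau h).
Proof.
move=> [/ltW h0 hd].
wlog ij : i j / (i < j)%N => [wl|] id jd.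
  rewrite neq_ltn => /orP[ij|ij]; first by apply: wl; rewrite // neq_ltn ij.
  apply: orth_sym; rewrite ?iter_tau_ge0//.
  by apply: wl; rewrite // neq_ltn ij.
move=> _; rewrite -(subnKC (ltnW ij)) iterD; apply: orth_iter; apply: hd.
by rewrite subn_gt0 ij (leq_ltn_trans (leq_subr _ _)).
Qed.

(** Disjoint orbit sums encode that all translates of different members are disjoint. Only the first
    [r] values of [h] matter. *)
Definition wandering_family r (h : nat -> V) :=
  (forall j, (j < r)%N -> wandering (h j)) /\
  forall i j, (i < r)%N -> (j < r)%N -> i != j ->
    orth (orbit_sum (h i)) (orbit_sum (h j)).

Lemma wandering_family_ext r (h : nat -> V) g : wandering_family r h -> wandering g ->
  (forall j, (j < r)%N -> orth (orbit_sum (h j)) (orbit_sum g)) ->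
  wandering_family r.+1 (fun j => if j == r then g else h j).
Proof.
move=> [hw ho] gw gh; split => [j|i j]; rewrite ltnS leq_eqVlt.
  by case: eqVneq => //= _ /hw.
have g0 : 0 <=v orbit_sum g by case: gw => /ltW ? _; exact: orbit_sum_ge0.
case: eqVneq => [->|ir] /= ilr; rewrite ltnS leq_eqVlt; case: eqVneq => [->|jr]/= jlr.
- by [].
- by move=> _; apply: orth_sym (gh _ jlr); rewrite // orbit_sum_ge0// ltW; case: (hw _ jlr).
- by move=> _; exact: gh.
- by move=> ij; exact: ho.
Qed.

Lemma wandering_family_sub r (h : nat -> V) j g : wandering_family r h -> (j < r)%N ->
  0 <v g -> g <=v h j ->
  wandering_family r (fun i => if i == j then g else h i).
Proof.
move=> [hw ho] jr g0 gh; set h' := fun i => _.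
have h'h i : (i < r)%N -> 0 <v h' i /\ h' i <=v h i.
  by move=> ir; rewrite /h'; case: eqVneq => [->//|_]; case: (hw _ ir).
have h'0 i : (i < r)%N -> 0 <=v orbit_sum (h' i).
  by move=> /h'h[/ltW ? _]; exact: orbit_sum_ge0.
split => [i ir|i k ir kr ik]; have [i0 ih] := h'h _ ir.
  exact: wandering_sub (hw _ ir).
have [k0 kh] := h'h _ kr.
apply: (orth_sub (h'0 _ ir) (orbit_sum_mono ih)).
apply: (orth_le_pos _ (h'0 _ kr) (orbit_sum_mono kh) (ho _ _ ir kr ik)).
exact: le_trans (h'0 _ ir) (orbit_sum_mono ih).
Qed.

(** Replace [h j] by [u] and append [v]. Proper translates of [u] are disjoint from [v] because
    [h j] is wandering, and [u] itself is by hypothesis. So the members of a family of maximal size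
    are atoms. *)
Lemma wandering_family_split r (h : nat -> V) j u v : wandering_family r h -> (j < r)%N ->
  0 <v u -> 0 <v v -> u <=v h j -> v <=v h j -> orth u v ->
  exists h' : nat -> V, wandering_family r.+1 h'.
Proof.
move=> hf jr u0 v0 uh vh uv.
have [hw ho] := hf; have hj := hw _ jr; have hj0 := ltW hj.1.
eexists; apply: (wandering_family_ext (wandering_family_sub hf jr u0 uh)).
  exact: wandering_sub v0 vh hj.
move=> i ir; case: eqVneq => [_|ij].
  apply: orth_orbit_sum => [||[//|k] kd]; rewrite ?ltW//.
  apply: (orth_sub (ltW u0) uh).
  apply: (@orth_le_pos _ _ _ _ (iter k.+1 tau (h j))) => //.
  - exact/iter_tau_ge0/ltW.
  - exact: iter_tau_le.
  - by apply: hj.2.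
apply: (@orth_le_pos _ _ _ _ (orbit_sum (h j))).
- by apply/orbit_sum_ge0/ltW; case: (hw _ ir).
- exact/orbit_sum_ge0/ltW.
- exact: orbit_sum_mono.
- exact: ho.
Qed.

Lemma wandering_family_orth n (h : nat -> V) i j k l : wandering_family n h ->
  (i < n)%N -> (j < n)%N -> (k < d)%N -> (l < d)%N -> (i, k) != (j, l) ->
  orth (iter k tau (h i)) (iter l tau (h j)).
Proof.
move=> [hw ho] ir jr kd ld; have [<-{jr}|ij _] := eqVneq i j.
  rewrite xpair_eqE eqxx /= => kl; apply: wandering_orth => //; exact: hw.
have h0 m : (m < n)%N -> 0 <=v h m by move=> /hw[/ltW].
apply: (@orth_sub _ _ (orbit_sum (h i))).
- exact/iter_tau_ge0/h0.
- exact/iter_le_orbit_sum/h0.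
apply: (@orth_le_pos _ _ _ _ (orbit_sum (h j))).
- exact/orbit_sum_ge0/h0.
- exact/iter_tau_ge0/h0.
- exact/iter_le_orbit_sum/h0.
- exact: ho.
Qed.

(** Isolating one term makes it a combination of elements disjoint from it, so it is disjoint from
    itself. *)
Lemma wandering_family_free n (h : nat -> V) (c : 'I_n -> 'I_d -> R) : wandering_family n h ->
  \sum_i \sum_j c i j *: iter j tau (h i) = 0 ->
  forall (i : 'I_n) (j : 'I_d), c i j = 0.
Proof.
move=> hf; rewrite pair_big /= => s0 i j.
have u0 : 0 <v iter j tau (h i) by apply: iter_tau_gt0; case: hf => /(_ i)[].
move: s0; rewrite (bigD1 (i, j))//= => /eqP; rewrite addr_eq0 => /eqP s0.
have : orth (iter j tau (h i)) (c i j *: iter j tau (h i)).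
  rewrite s0; apply/orthN/orth_sum; first exact: ltW.
  move=> [i' j'] /= ne; apply/orthZ; first exact: ltW.
  apply: (wandering_family_orth hf) => //.
  by apply: contra ne => /eqP[/val_inj-> /val_inj->].
apply: contraPP => c0 /(orthZ (c i j)^-1 (ltW u0)).
rewrite scalerA mulVf ?scale1r; last exact/eqP.
by move=> /(orth_self (ltW u0)) u00; rewrite u00 ltxx in u0.
Qed.

(** * Sectors of an eigenvector and the existence of wandering elements *)

Section Eigenpair.
Variables (l : R[i]) (x y : V).
Hypothesis l_prim : d.-primitive_root l.
Hypothesis tau_x : tau x = complex.Re l *: x - complex.Im l *: y.
Hypothesis tau_y : tau y = complex.Re l *: y + complex.Im l *: x.
Implicit Types w m : R[i].

Let comb (p q : R) : V := p *: x + q *: y.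

Let combD p q p' q' : comb p q + comb p' q' = comb (p + p') (q + q').
Proof. by rewrite /comb !scalerDl addrACA. Qed.

Let combZ a p q : a *: comb p q = comb (a * p) (a * q).
Proof. by rewrite /comb scalerDr !scalerA. Qed.

Let combN p q : - comb p q = comb (- p) (- q).
Proof. by rewrite -scaleN1r combZ !mulN1r. Qed.

(** This is Re(w z) for the eigenvector z = x + i y. *)
Definition re_part w : V := complex.Re w *: x - complex.Im w *: y.

Let re_partE w : re_part w = comb (complex.Re w) (- complex.Im w).
Proof. by rewrite /comb scaleNr. Qed.

Lemma tau_re_part w : tau (re_part w) = re_part (l * w).
Proof.
rewrite re_partE {1}/comb linearD !linearZ /= tau_x tau_y -scaleNr.
rewrite -[_ *: y + _ *: x]addrC -!/(comb _ _) !combZ combD re_partE.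
by case: l w => [a b] [c e] /=; congr comb; ring.
Qed.

Lemma re_partB w m : re_part (w - m) = re_part w - re_part m.
Proof.
rewrite !re_partE combN combD; case: w m => [a b] [c e] /=.
by congr comb; rewrite opprB opprK addrC.
Qed.

(** An invariant substitute for |z|: elements disjoint from [x] and [y] are disjoint from it, since
    the translates of [x] and [y] are real combinations of [x] and [y]. *)
Definition modulus_sum : V := orbit_sum (rabs x + rabs y).

Lemma modulus_sum_ge0 : 0 <=v modulus_sum.
Proof. exact/orbit_sum_ge0/rz_addr_ge0. Qed.

Lemma orth_iter_eigenpair u i : 0 <=v u -> orth u x -> orth u y ->
  orth u (iter i tau x) /\ orth u (iter i tau y).
Proof.
move=> u0 ux uy; elim: i => //= i [ix iy].
have itauE z : tau (iter i tau z) = iter i tau (tau z) by rewrite -iterS iterSr.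
have iD z1 z2 : iter i tau (z1 + z2) = iter i tau z1 + iter i tau z2.
  by elim: (i) => //= k ->; rewrite linearD.
have iZ a z : iter i tau (a *: z) = a *: iter i tau z.
  by elim: (i) => //= k ->; rewrite linearZ.
rewrite !itauE tau_x tau_y !iD -scaleNr !iZ.
by split; apply: orthD => //; exact: orthZ.
Qed.

Lemma orth_modulus_sum u : 0 <=v u -> orth u x -> orth u y ->
  orth u modulus_sum.
Proof.
move=> u0 ux uy; apply: orth_sum => // i _.
have [ix iy] := orth_iter_eigenpair i u0 ux uy.
have -> : iter i tau (rabs x + rabs y) = rabs (iter i tau x) + rabs (iter i tau y).
  rewrite -!iter_tau_rabs; elim: (nat_of_ord i) => //= k ->.
  by rewrite linearD.
by apply: orthD => //; exact: orth_rabs.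
Qed.

(** Cramer's rule: with non-zero determinant, [x] and [y] are combinations of the two real parts. *)
Lemma orth_re_parts u m1 m2 : 0 <=v u ->
  complex.Re m1 * complex.Im m2 != complex.Im m1 * complex.Re m2 ->
  orth u (re_part m1) -> orth u (re_part m2) -> orth u x /\ orth u y.
Proof.
case: m1 m2 => [a b] [c e] /= u0; rewrite -subr_eq0 => D0.
rewrite !re_partE /= => o1 o2.
have orthV z : orth u ((a * e - b * c) *: z) -> orth u z.
  move=> /(orthZ (a * e - b * c)^-1 u0).
  by rewrite scalerA mulVf// scale1r.
have combx p : comb p 0 = p *: x by rewrite /comb scale0r addr0.
have comby p : comb 0 p = p *: y by rewrite /comb scale0r add0r.
split; apply: orthV.
  have -> : (a * e - b * c) *: x = e *: comb a (- b) - b *: comb c (- e).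
    by rewrite !combZ combN combD -combx; congr comb; ring.
  by apply: orthB => //; apply: orthZ.
have -> : (a * e - b * c) *: y = c *: comb a (- b) - a *: comb c (- e).
  by rewrite !combZ combN combD -comby; congr comb; ring.
by apply: orthB => //; apply: orthZ.
Qed.

(* Where [Re (w z)] exceeds all the other [Re (l^i w z)]: the sector of angle
   [2 pi / d] around the direction of [conj w]. *)
Definition sector w : V :=
  foldr (fun i v => rpos (re_part w - re_part (l ^+ i * w)) `&` v)
    modulus_sum (iota 1 d.-1).

Lemma sector_ge0 w : 0 <=v sector w.
Proof.
rewrite /sector; elim: iota => [|i s IH] /=; first exact: modulus_sum_ge0.
exact: rz_meet_ge0.
Qed.

Lemma sector_le_modulus w : sector w <=v modulus_sum.
Proof.
by rewrite /sector; elim: iota => //= i s IH; rewrite (le_trans (leIr _ _)).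
Qed.

Lemma sector_le w i : (0 < i < d)%N ->
  sector w <=v rpos (re_part w - re_part (l ^+ i * w)).
Proof.
move=> id; have : i \in iota 1 d.-1.
  by rewrite mem_iota add1n prednK.
rewrite /sector; elim: iota => //= j s IH; rewrite inE => /predU1P[->|/IH].
  exact: leIl.
by move=> h; rewrite (le_trans (leIr _ _)) ?h.
Qed.

Lemma tau_sector w : tau (sector w) = sector (l * w).
Proof.
rewrite /sector; elim: iota => [|i s IH] /=; first exact: tau_orbit_sum.
rewrite tau_meet IH tau_rpos linearB !tau_re_part.
by rewrite mulrCA.
Qed.

Lemma iter_sector i w : iter i tau (sector w) = sector (l ^+ i * w).
Proof.
elim: i => [|i IH] /=; first by rewrite mul1r.
by rewrite IH tau_sector mulrA exprS.
Qed.

(** Inside [sector w] one has Re(w z) > Re(l^i w z). The translate is [sector (l ^+ i * w)], where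
    comparison with its multiple by [l ^+ (d - i)] gives the opposite strict inequality. *)
Lemma wandering_sector w : sector w != 0 -> wandering (sector w).
Proof.
move=> s0; split=> [|i id]; first by rewrite lt_def s0 sector_ge0.
rewrite iter_sector.
apply: (orth_sub (sector_ge0 w) (sector_le w id)).
have id' : (0 < d - i < d)%N.
  by case/andP: id => i0 id; rewrite subn_gt0 id ltn_subrL i0.
apply: (orth_le_pos _ (sector_ge0 _) (sector_le (l ^+ i * w) id')) => //.
rewrite mulrA -exprD subnK; last by case/andP: id => _ /ltnW.
rewrite (prim_expr_order l_prim) mul1r orthP// -[X in _ `&` rpos X]opprB.
exact: rpos_disj.
Qed.

(** Shrinks [u] until one [F j] is the largest of the [F i] on it. At each new index, splitting
    along the positive and negative part of [F n.+1 - F j] decides whether the maximum changes. *)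
Lemma orth_split_max (F : nat -> V) n u : 0 <v u -> exists u' : V,
  [/\ 0 <v u', u' <=v u &
   exists2 j, (j <= n)%N & forall i, (i <= n)%N -> orth u' (rpos (F i - F j))].
Proof.
move=> u0; elim: n => [|n [u' [u'0 u'u [j jn max]]]].
  exists u; split => //; exists 0%N => // -[|//] _.
  by rewrite subrr rpos_npos//; apply/orth0/ltW.
have := orth_split u'0 (rpos_ge0 (F n.+1 - F j)) (rpos_ge0 (- (F n.+1 - F j))).
case; first by rewrite orthP// rpos_disj.
move=> v [v0 vu'] split; exists v; split => //; first exact: le_trans u'u.
have vmax i : (i <= n)%N -> orth v (rpos (F i - F j)).
  by move=> /max; apply: orth_sub => //; exact: ltW.
case: split => [oj|on].
  exists j => [|i]; first exact: leqW.
  by rewrite leq_eqVlt => /predU1P[->//|]; rewrite ltnS => /vmax.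
exists n.+1 => // i; rewrite leq_eqVlt => /predU1P[->|].
  by rewrite subrr rpos_npos//; apply/orth0/ltW.
rewrite ltnS => /vmax oi; move: (orthD (ltW v0) oi on).
apply: orth_le_pos => //; first exact: ltW.
have -> : F i - F n.+1 = (F i - F j) + - (F n.+1 - F j).
  by rewrite opprB addrA subrK.
exact: rposD.
Qed.

(** Either [u] is already disjoint from the first positive part, or its meet with that part is
    non-zero and the search goes on inside this meet. It cannot run out of factors, because [u <= e]
    is not disjoint from [e]. *)
Lemma orth_split_meet (F : nat -> V) e (s : seq nat) u : 0 <v u -> u <=v e ->
  orth u (foldr (fun i v => rpos (F i) `&` v) e s) ->
  exists u' : V, [/\ 0 <v u', u' <=v u &
   exists2 i, i \in s & orth u' (rpos (F i))].
Proof.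
move=> u0 ue; have e0 : 0 <=v e by apply: le_trans ue; exact: ltW.
elim: s u u0 ue => /= [u u0 ue uoe|i s IH u u0 ue].
  by have := orth_le_eq0 (ltW u0) ue uoe => uE; rewrite uE ltxx in u0.
have m0 : 0 <=v foldr (fun i v => rpos (F i) `&` v) e s.
  by elim: s {IH} => //= j s ?; exact: rz_meet_ge0.
rewrite orthP ?rz_meet_ge0// meetA => um.
have [uF|uF] := eqVneq (u `&` rpos (F i)) 0.
  exists u; split => //; exists i; rewrite ?mem_head//.
  by rewrite orthP.
have v0 : 0 <v u `&` rpos (F i) by rewrite lt_def uF rz_meet_ge0// ltW.
have vu : u `&` rpos (F i) <=v u by exact: leIl.
have [|u' [u'0 u'v [j js oj]]] := IH _ v0 (le_trans vu ue).
  by rewrite orthP.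
exists u'; split => //; first exact: le_trans vu.
by exists j => //; rewrite inE js orbT.
Qed.

(** Shrink [u] so that one Re(l^j w z) is maximal on it. As the sector of [l ^+ j * w] vanishes,
    some other Re(l^(j+i) w z) ties with it on a smaller part, and there the difference of the two
    is zero. *)
Lemma no_sector_edge w u : (forall w', sector w' = 0) -> 0 <v u -> u <=v modulus_sum ->
  exists u' : V, [/\ 0 <v u', u' <=v u &
    exists i j, (0 < i < d)%N /\ orth u' (re_part (l ^+ j * (1 - l ^+ i) * w))].
Proof.
move=> no u0 ue.
have [v [v0 vu [j _ max]]] :=
  orth_split_max (fun i => re_part (l ^+ i * w)) d.-1 u0.
have ov : orth v (sector (l ^+ j * w)) by rewrite no; exact/orth0/ltW.
have [u' [u'0 u'v [i id oi]]] := orth_split_meet v0 (le_trans vu ue) ov.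
rewrite mem_iota add1n prednK// in id.
exists u'; split => //; first exact: le_trans vu.
exists i, j; split => //.
rewrite mulrBr mulr1 mulrBl -mulrA re_partB.
apply: orth_pos_neg; rewrite ?(ltW u'0)//.
  by rewrite mulrCA in oi.
(* Maximality covers only exponents below [d], so [j + i] is reduced modulo [d]. *)
rewrite opprB mulrA -exprD -(prim_expr_mod l_prim (j + i)).
apply: (orth_sub (ltW u'0) u'v); apply: max.
by rewrite -ltnS prednK// ltn_mod.
Qed.

(** If all sectors vanish, a common [u] carries two ties, one for the direction [1] and one for [w].
    They are not parallel, so [x] and [y] both vanish on [u], although [0 < u <= modulus_sum]. *)
Lemma exists_wandering : (x != 0) || (y != 0) ->
  exists2 h : V, wandering h & h <=v modulus_sum.
Proof.
move=> xy0; apply: contrapT => nw.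
have no w : sector w = 0.
  apply/eqP; apply: contra_notT nw => /wandering_sector sw.
  by exists (sector w) => //; exact: sector_le_modulus.
have e0 : 0 <v modulus_sum.
  rewrite lt_def modulus_sum_ge0 andbT; apply: contraTneq xy0 => e0.
  have le0 z : rabs z <=v rabs x + rabs y -> z = 0.
    move=> zle; apply: rabs_eq0; apply/le_anti; rewrite rabs_ge0 andbT -e0.
    by apply: (le_trans zle); apply: le_orbit_sum; exact: rz_addr_ge0.
  have x0 : x = 0 by apply: le0; rewrite -[leLHS]addr0 rz_leD2l.
  have y0 : y = 0 by apply: le0; rewrite -[leLHS]add0r rz_leD2r.
  by rewrite negb_or !negbK; apply/andP; split; apply/eqP.
(* A difference [m] of two distinct powers of [l] satisfies [m ^+ (2 * d) = conjc m ^+ (2 * d)].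
   Were the two ties parallel, cancelling these powers would force the same identity on [w], which
   is chosen to violate it. *)
have dd0 : (0 < 2 * d)%N by rewrite muln_gt0.
have [w ww] := @exists_conj_pow_neq R _ dd0.
have [u1 [u10 u1e [i1 [j1 [id1 o1]]]]] := no_sector_edge 1 no e0 (lexx _).
have [u [u0 uu1 [i [j [id o]]]]] := no_sector_edge w no u10 u1e.
have {}o1 := orth_sub (ltW u0) uu1 o1.
rewrite mulr1 in o1.
have ld := prim_expr_order l_prim.
have l0 : l != 0.
  by apply: contra_eq_neq ld => ->; rewrite expr0n gtn_eqF// eq_sym oner_eq0.
have edge0 i' j' : (0 < i' < d)%N -> l ^+ j' * (1 - l ^+ i') != 0.
  move=> /andP[i'0 i'd]; rewrite mulf_neq0 ?expf_neq0//.
  rewrite subr_eq0 eq_sym -(prim_order_dvd l_prim).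
  by apply/negP => /(dvdn_leq i'0); rewrite leqNgt i'd.
have e1 := unity_root_diff_conj i1 j1 d_gt0 ld.
have e2 := unity_root_diff_conj i j d_gt0 ld.
have n1 := edge0 i1 j1 id1; have n2 := edge0 i j id.
move: (l ^+ j1 * _) (l ^+ j * _) o1 o e1 e2 n1 n2 => m1 m2 o1 o /= e1 e2 n1 n2.
have [ox oy] : orth u x /\ orth u y.
  apply: (orth_re_parts (ltW u0) _ o1 o); apply: contra ww => /eqP/cross_eq0.
  rewrite rmorphM /= => /(congr1 (fun z => z ^+ (2 * d))).
  rewrite !exprMn -e1 -e2 => /mulfI; rewrite expf_neq0// => /(_ isT) /mulfI.
  by rewrite expf_neq0// => /(_ isT) ->.
have := orth_modulus_sum (ltW u0) ox oy.
move=> /(orth_le_eq0 (ltW u0) (le_trans uu1 u1e)) uE.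
by rewrite uE ltxx in u0.
Qed.

End Eigenpair.

Lemma wandering_family_atom r (h : nat -> V) j : wandering_family r h ->
  (forall h' : nat -> V, ~ wandering_family r.+1 h') -> (j < r)%N ->
  forall f, exists c : R, orth (h j) (f - c *: h j).
Proof.
move=> hf max jr; apply: atom_coef => [|u v u0 v0 uh vh uv].
  by case: hf => /(_ _ jr)[].
by have [h' /max] := wandering_family_split hf jr u0 v0 uh vh uv.
Qed.

(** * From independent eigenvectors to a wandering family of the same size *)

Section EigenvectorFamily.
Variables (l : R[i]) (n : nat) (X Y : 'I_n -> V).
Hypothesis l_prim : d.-primitive_root l.
Hypothesis tau_X : forall i : 'I_n,
  tau (X i) = complex.Re l *: X i - complex.Im l *: Y i.
Hypothesis tau_Y : forall i : 'I_n,
  tau (Y i) = complex.Re l *: Y i + complex.Im l *: X i.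

(** With [lin_im], the real and imaginary part of the complex combination of the X_i + i Y_i with
    coefficients [c]. *)
Definition lin_re (c : 'I_n -> R[i]) : V :=
  \sum_i (complex.Re (c i) *: X i - complex.Im (c i) *: Y i).
Definition lin_im (c : 'I_n -> R[i]) : V :=
  \sum_i (complex.Re (c i) *: Y i + complex.Im (c i) *: X i).

Lemma tau_lin_re c :
  tau (lin_re c) = complex.Re l *: lin_re c - complex.Im l *: lin_im c.
Proof.
rewrite linear_sum !scaler_sumr -sumrB; apply: eq_bigr => i _.
rewrite linearB !linearZ /= tau_X tau_Y !(scalerN, scalerDr) !scalerA.
rewrite ![complex.Re l * _]mulrC ![complex.Im l * _]mulrC !opprD !addrA.
by congr (_ - _); rewrite addrAC.
Qed.

Lemma tau_lin_im c :
  tau (lin_im c) = complex.Re l *: lin_im c + complex.Im l *: lin_re c.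
Proof.
rewrite linear_sum !scaler_sumr -big_split; apply: eq_bigr => i _.
rewrite linearD !linearZ /= tau_X tau_Y !(scalerN, scalerDr) !scalerA.
rewrite ![complex.Re l * _]mulrC ![complex.Im l * _]mulrC !addrA.
by congr (_ - _); rewrite addrAC.
Qed.

(** The members of a family of maximal size are atoms, so each eigenvector has [r] complex
    coefficients on them. As [r < n], the coefficient matrix has a non-trivial row relation [c], and
    the corresponding combination is disjoint from every [h j]. *)
Lemma maximal_wandering_dependent r (h : nat -> V) : wandering_family r h ->
  (forall h' : nat -> V, ~ wandering_family r.+1 h') -> (r < n)%N ->
  exists c : 'I_n -> R[i], [/\ exists i : 'I_n, c i != 0, lin_re c = 0 & lin_im c = 0].
Proof.
move=> hf max rn; have [hw ho] := hf.
have h0 j : (j < r)%N -> 0 <=v h j by move=> /hw[/ltW].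
pose coef f (j : 'I_r) := sval (cid (wandering_family_atom hf max (ltn_ord j) f)).
have coefP f (j : 'I_r) : orth (h j) (f - coef f j *: h j) by rewrite /coef; case: cid.
pose M : 'M[R[i]]_(n, r) := \matrix_(i, j) Complex (coef (X i) j) (coef (Y i) j).
have kM : kermx M != 0.
  rewrite -mxrank_eq0 mxrank_ker subn_eq0 -ltnNge.
  exact: leq_ltn_trans (rank_leq_col M) rn.
pose c (i : 'I_n) := nz_row (kermx M) 0 i.
have cM (j : 'I_r) : \sum_i c i * M i j = 0.
  have /sub_kermxP/matrixP/(_ 0 j) := nz_row_sub (kermx M).
  by rewrite !mxE.
exists c; have c0 : exists i : 'I_n, c i != 0.
  by apply/rV0Pn; rewrite nz_row_eq0.
have orthS (F : 'I_n -> V) (t : 'I_n -> R) (j : 'I_r) :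
    (forall i : 'I_n, orth (h j) (F i - t i *: h j)) -> \sum_i t i = 0 ->
    orth (h j) (\sum_i F i).
  move=> Ft t0; have -> : \sum_i F i = \sum_i (F i - t i *: h j).
    by rewrite sumrB -scaler_suml t0 scale0r subr0.
  by apply: orth_sum => [|i _]; [exact: h0|exact: Ft].
have oXY (i : 'I_n) (j : 'I_r) : orth (h j) (X i - coef (X i) j *: h j) /\
    orth (h j) (Y i - coef (Y i) j *: h j) by split; exact: coefP.
have o_re (j : 'I_r) : orth (h j) (lin_re c).
  rewrite /lin_re /lin_im.
  apply: (orthS _ (fun i : 'I_n => complex.Re (c i * M i j)) j) => [i|]; last first.
    by rewrite -raddf_sum cM.
  rewrite mxE; case: (c i) => a b /=; have [oX oY] := oXY i j.
  have := orthB (h0 _ (ltn_ord j)) (orthZ a (h0 _ (ltn_ord j)) oX)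
    (orthZ b (h0 _ (ltn_ord j)) oY).
  by rewrite !scalerBr !scalerA scalerBl !opprD addrACA.
have o_im (j : 'I_r) : orth (h j) (lin_im c).
  rewrite /lin_re /lin_im.
  apply: (orthS _ (fun i : 'I_n => complex.Im (c i * M i j)) j) => [i|]; last first.
    by rewrite -raddf_sum cM.
  rewrite mxE; case: (c i) => a b /=; have [oX oY] := oXY i j.
  have := orthD (h0 _ (ltn_ord j)) (orthZ a (h0 _ (ltn_ord j)) oY)
    (orthZ b (h0 _ (ltn_ord j)) oX).
  by rewrite !scalerBr !scalerA addrACA -opprD -scalerDl.
(* The combination is again an eigenvector for [l]. If it were non-zero, it would yield a wandering
   element below its modulus sum, with orbit disjoint from every [h j], against maximality. *)
have : ~~ ((lin_re c != 0) || (lin_im c != 0)).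
  apply/negP => xy0.
  have [g gw ge] := exists_wandering l_prim (tau_lin_re c) (tau_lin_im c) xy0.
  apply: (max _ (wandering_family_ext hf gw _)) => j jr.
  apply: orth_orbit_sum => [||i _]; [exact: h0|exact: ltW gw.1|].
  have oe : orth (h j) (modulus_sum (lin_re c) (lin_im c)).
    apply: (orth_modulus_sum (tau_lin_re c) (tau_lin_im c)); first exact: h0.
      exact: o_re (Ordinal jr).
    exact: o_im (Ordinal jr).
  apply: orth_le_pos oe; first exact: h0.
    exact/iter_tau_ge0/ltW/gw.1.
  by rewrite /modulus_sum -(iter_orbit_sum i); exact: iter_tau_le.
by rewrite negb_or !negbK => /andP[/eqP re0 /eqP im0].
Qed.

Lemma free_wandering_family :
  (forall c, lin_re c = 0 -> lin_im c = 0 -> forall i : 'I_n, c i = 0) ->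
  exists h : nat -> V, wandering_family n h.
Proof.
move=> free; suff: forall r, (r <= n)%N -> exists h : nat -> V, wandering_family r h.
  exact.
elim=> [_|r IH rn]; first by exists (fun=> 0); split.
have [h hf] := IH (ltnW rn); apply: contrapT => no.
have max (h' : nat -> V) : ~ wandering_family r.+1 h' by move=> ?; apply: no; exists h'.
have [c [[i ci0] cre cim]] := maximal_wandering_dependent hf max rn.
by move: ci0; rewrite free ?eqxx.
Qed.

End EigenvectorFamily.

End PeriodicAutomorphism.

(** * The fixed space of a positive contraction *)

Section BanachLatticeRiesz.
Context {R : realType} (E : banachLatticeType R).
Implicit Types x y : E.

Lemma lat_join_opp x : lat_le 0 x -> lat_join x (- x) = x.
Proof.
move=> x0; apply: lat_le_anti; rewrite lat_joinP lat_le_refl /=.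
have nx0 : lat_le (- x) 0.
  by have := @lat_leD R E _ _ (- x) x0; rewrite add0r subrr.
rewrite (lat_le_trans _ _ _ nx0 x0)/=.
by have := lat_le_refl (lat_join x (- x)); rewrite lat_joinP => /andP[].
Qed.

Lemma lat_le_norm x y : lat_le 0 x -> lat_le x y -> `|x| <= `|y|.
Proof.
move=> x0 xy; apply: lat_norm.
by rewrite !lat_join_opp//; exact: lat_le_trans xy.
Qed.

(** The positive part of [x] is at most 1/(n+1) times that of [y] for every [n]; by monotonicity of
    the norm its norm is zero. *)
Lemma lat_archimedean x y : (forall n : nat, lat_le (x *+ n) y) -> lat_le x 0.
Proof.
move=> xy; pose p := lat_join x 0; pose q := lat_join y 0.
have ubl (a b : E) : lat_le a (lat_join a b) /\ lat_le b (lat_join a b).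
  by have := lat_le_refl (lat_join a b); rewrite lat_joinP => /andP[].
have p0 : lat_le 0 p by case: (ubl x 0).
have q0 : lat_le 0 q by case: (ubl y 0).
have pq (n : nat) : lat_le p (n.+1%:R^-1 *: q).
  have n0 : 0 <= n.+1%:R^-1 :> R by rewrite invr_ge0.
  rewrite lat_joinP -[X in _ && lat_le X _](scaler0 _ (n.+1%:R^-1 : R)) lat_leZ// andbT.
  have := lat_leZ _ _ _ n0 (lat_le_trans _ _ _ (xy n.+1) (ubl y 0).1).
  by rewrite -[x *+ _]scaler_nat scalerA mulVf// scale1r.
have pn (n : nat) : `|p| *+ n <= `|q|.
  case: n => [|n]; first by rewrite mulr0n.
  have := lat_le_norm p0 (pq n).
  by rewrite normrZ ger0_norm ?invr_ge0// ler_pdivlMl// mulr_natl.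
have /eqP : `|p| = 0.
  apply/le_anti; rewrite normr_ge0 andbT leNgt; apply/negP => p_gt0.
  have := pn (Num.truncn (`|q| / `|p|)).+1.
  rewrite leNgt => /negP; apply.
  by rewrite -mulr_natl -ltr_pdivrMr// truncnS_gt.
by rewrite normr_eq0 => /eqP pE; have := (ubl x 0).1; rewrite -/p pE.
Qed.

HB.instance Definition _ := isRiesz.Build R (BanachLattice.sort E)
  (@lat_le_refl R E) (@lat_le_anti R E) (@lat_le_trans R E)
  (@lat_joinP R E) (@lat_meetP R E) (@lat_leD R E) (@lat_leZ R E)
  lat_archimedean.

(* Chains are the only nets that Zorn's lemma asks for. *)
Lemma chain_sup (A : set E) M : monotonically_complete E -> fatou_property E ->
  (A !=set0)%classic -> total_on A (fun x y => x <=v y) ->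
  (forall x, A x -> 0 <=v x /\ `|x| <= M) ->
  exists s : E, [/\ forall x, A x -> x <=v s,
    forall u : E, (forall x, A x -> x <=v u) -> s <=v u & `|s| <= M].
Proof.
move=> mono fatou [x0 Ax0] Atot AM.
pose J := {x : E | A x}; pose leJ (i j : J) : Prop := sval i <=v sval j.
have net : increasing_positive_net leJ (@sval _ _).
  split => //; last by move=> [x Ax] /=; case: (AM x Ax).
  split; first exact: (inhabits (exist _ x0 Ax0)).
  - by move=> i; exact: lexx.
  - by move=> i j k; exact: le_trans.
  - move=> [i Ai] [j Aj]; case: (Atot i j Ai Aj) => ij.
      by exists (exist _ j Aj); split => //; exact: lexx.
    by exists (exist _ i Ai); split => //; exact: lexx.
have [|s sP] := mono J leJ _ net.
  by exists M => -[x Ax] /=; case: (AM x Ax).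
exists s; split.
- by move=> x Ax; apply: sP.1; exists (exist _ x Ax).
- by move=> u uA; apply: sP.2 => _ [[x Ax] _ <-]; exact: uA.
- rewrite (fatou J leJ _ s net sP); apply: ge_sup.
    by exists `|x0|, (exist _ x0 Ax0).
  by move=> _ [[x Ax] _ <-] /=; case: (AM x Ax).
Qed.

End BanachLatticeRiesz.

(** * Least fixed points and the lattice structure of the fixed space *)

Section FixedSpace.
Context {R : realType} {E : banachLatticeType R} (S : {linear E -> E}).
Implicit Types x y w f g : E.

Definition positive_contraction :=
  [/\ monotonically_complete E, fatou_property E,
      forall x, 0 <=v x -> 0 <=v S x & forall x, 0 <=v x -> `|S x| <= `|x|].
Hypothesis S_pc : positive_contraction.

Lemma pos_contr_le x y : x <=v y -> S x <=v S y.
Proof.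
have [_ _ S0 _] := S_pc.
by rewrite -rz_subr_ge0 => /S0; rewrite linearB rz_subr_ge0.
Qed.

(** Zorn's lemma replaces the transfinite iteration. In [D], the norm bound makes suprema of chains
    exist and the last clause makes the result least. [D] is stable under [S], so a maximal
    [y <= S y] is fixed. *)
Lemma least_fixed_point w : 0 <=v w -> w <=v S w ->
  exists f, [/\ S f = f, w <=v f & forall g, S g = g -> w <=v g -> f <=v g].
Proof.
have [mono fatou S_ge0 S_contr w0 wS] := S_pc.
pose D y := [/\ w <=v y, y <=v S y, `|y| <= `|w| &
  forall g, S g = g -> w <=v g -> y <=v g].
have Dw : D w by split.
pose leD (s t : {y | D y}) := sval s <=v sval t.
have [||||[y Dy] ymax] := @Zorn {y | D y} leD.
- by move=> t; exact: lexx.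
- by move=> r s t; exact: le_trans.
- move=> [s Ds] [t Dt] st ts.
  by apply: eq_exist; apply/le_anti/andP.
- move=> A Atot; have [[a Aa]|A0] := pselect (A !=set0)%classic; last first.
    exists (exist _ w Dw) => s As; exfalso; apply: A0; by exists s.
  pose B := [set sval a | a in A]%classic.
  have [|||s [sub slub sM]] := @chain_sup _ E B `|w| mono fatou.
  + by exists (sval a), a.
  + by move=> _ _ [s As <-] [t At <-]; exact: Atot.
  + move=> _ [[y [wy ? yM ?]] _ <-] /=; split => //; exact: le_trans w0 wy.
  have Ds : D s.
    split=> //.
    * by case: (svalP a) => wa _ _ _; apply: (le_trans wa); apply: sub; exists a.
    * apply: slub => _ [[y [wy yS yM yg]] Ay <-] /=.
      apply: (le_trans yS); apply: pos_contr_le; apply: sub.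
      by eexists; [exact: Ay|].
    * move=> g Sg wg; apply: slub => _ [[y [wy yS yM yg]] _ <-] /=; exact: yg.
  by exists (exist _ s Ds) => t At; apply: sub; exists t.
have [wy yS yM yg] := Dy; have y0 := le_trans w0 wy.
have DSy : D (S y).
  split; first exact: le_trans yS.
  - exact: pos_contr_le.
  - exact: le_trans (S_contr _ y0) yM.
  - by move=> g Sg wg; rewrite -Sg; apply: pos_contr_le; exact: yg.
exists y; split => //.
by have /(congr1 sval) := ymax (exist _ _ DSy) yS.
Qed.

Definition fixed_pred : {pred E} := fun x => S x == x.

Fact fixed_pred_submod : submod_closed fixed_pred.
Proof.
split=> [|a x y]; rewrite !unfold_in ?linear0//.
by move=> /eqP Sx /eqP Sy; rewrite linearP Sx Sy.
Qed.
HB.instance Definition _ :=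
  GRing.isSubmodClosed.Build R E fixed_pred fixed_pred_submod.

(* The proof of [positive_contraction] is a parameter of the type, so that the
   Riesz structure below can be inferred from it. *)
Record fixed_space (HS : positive_contraction) :=
  FixedSpace { fixed_val :> E ; fixed_valP : fixed_val \in fixed_pred }.

HB.instance Definition _ := [isSub for @fixed_val S_pc].
HB.instance Definition _ := [Choice of fixed_space S_pc by <:].
HB.instance Definition _ := [SubChoice_isSubLmodule of fixed_space S_pc by <:].

Local Notation F := (fixed_space S_pc).
Implicit Types a b c : F.

Lemma fixed_valE a : S (val a) = val a.
Proof. exact/eqP/(valP a). Qed.

Lemma fixed_valD a b : val (a + b) = val a + val b. Proof. exact: raddfD. Qed.
Lemma fixed_valB a b : val (a - b) = val a - val b. Proof. exact: raddfB. Qed.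
Lemma fixed_valZ (t : R) a : val (t *: a) = t *: val a.
Proof. exact: linearZ_LR. Qed.
Lemma fixed_val_sum n (f : 'I_n -> F) : val (\sum_i f i) = \sum_i val (f i).
Proof. exact: raddf_sum. Qed.

(** The join is [a] plus the least fixed point above the positive part of [b - a]; positivity of [S]
    puts this positive part below its own image, as the iteration requires. *)
Lemma fixed_joinP a b : exists c, forall z : F,
  (val c <=v val z) = (val a <=v val z) && (val b <=v val z).
Proof.
have [_ _ S_ge0 _] := S_pc.
pose w := rpos (val b - val a).
have w0 : 0 <=v w by exact: rpos_ge0.
have wS : w <=v S w.
  rewrite leUx S_ge0// andbT -[leLHS](_ : S (val b - val a) = _).
    by apply: pos_contr_le; exact: rpos_ge.
  by rewrite linearB !fixed_valE.
have [f [Sf wf fmin]] := least_fixed_point w0 wS.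
have cP : val a + f \in fixed_pred by rewrite unfold_in linearD fixed_valE Sf.
exists (FixedSpace S_pc cP) => z /=; apply/idP/andP => [afz|[az bz]].
  split; apply: le_trans afz.
    by rewrite -[leLHS]addr0 rz_leD2l; exact: le_trans w0 wf.
  by rewrite addrC -rz_lerBlDr; apply: le_trans wf; exact: rpos_ge.
rewrite addrC -rz_lerBrDr; apply: fmin; first by rewrite linearB !fixed_valE.
by rewrite leUx rz_leD2r bz rz_subr_ge0.
Qed.

Definition fixed_le a b := val a <=v val b.
Definition fixed_join a b : F := sval (cid (fixed_joinP a b)).
Definition fixed_meet a b : F := - fixed_join (- a) (- b).

Fact fixed_le_anti : antisymmetric fixed_le.
Proof. by move=> a b; rewrite /fixed_le => /le_anti/val_inj. Qed.

Fact fixed_join_le a b c :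
  fixed_le (fixed_join a b) c = fixed_le a c && fixed_le b c.
Proof. exact: (svalP (cid (fixed_joinP a b))). Qed.

Fact fixed_meet_le a b c :
  fixed_le a (fixed_meet b c) = fixed_le a b && fixed_le a c.
Proof.
have leN (x y : F) : fixed_le (- x) y = fixed_le (- y) x.
  by have := rz_leN (val x) (- val y); rewrite opprK /fixed_le !raddfN.
have leN' (x y : F) : fixed_le x (- y) = fixed_le y (- x).
  by rewrite -[in LHS](opprK x) leN opprK.
by rewrite /fixed_meet leN' fixed_join_le leN opprK leN opprK.
Qed.

Fact fixed_leD a b c : fixed_le a b -> fixed_le (a + c) (b + c).
Proof. by rewrite /fixed_le !raddfD rz_leD2r. Qed.

Fact fixed_leZ (t : R) a b : 0 <= t -> fixed_le a b -> fixed_le (t *: a) (t *: b).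
Proof. by move=> t0 ab; rewrite /fixed_le !linearZ rz_leZ. Qed.

Fact fixed_archimedean a b :
  (forall n : nat, fixed_le (a *+ n) b) -> fixed_le a 0.
Proof.
move=> ab; rewrite /fixed_le raddf0; apply: (@rz_archimedean _ _ _ (val b)) => n.
by have := ab n; rewrite /fixed_le raddfMn.
Qed.

HB.instance Definition _ := isRiesz.Build R F
  (fun a => lexx (val a)) fixed_le_anti (fun b a c => @le_trans _ _ (val b) _ _)
  fixed_join_le fixed_meet_le fixed_leD fixed_leZ fixed_archimedean.

End FixedSpace.

(** * Restriction of the operator to the fixed space of its power *)

Section PeriodicRestriction.
Context {R : realType} {E : banachLatticeType R} (T : {linear E -> E}).
Hypotheses (E_mono : monotonically_complete E) (E_fatou : fatou_property E).
Hypothesis T_ge0 : forall x : E, 0 <=v x -> 0 <=v T x.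
Hypothesis T_contr : forall x : E, 0 <=v x -> `|T x| <= `|x|.
Variable d : nat.
Hypothesis d_gt0 : (0 < d)%N.

Definition iterated : E -> E := iter d T.

Fact iterated_linear : linear iterated.
Proof.
by move=> a x y; rewrite /iterated; elim: d => //= i ->; rewrite linearP.
Qed.
HB.instance Definition _ :=
  GRing.isLinear.Build R E E *:%R iterated iterated_linear.

Fact iterated_pc : positive_contraction iterated.
Proof.
have iter_ge0 i (x : E) : 0 <=v x -> 0 <=v iter i T x.
  by move=> x0; elim: i => //= i; exact: T_ge0.
split=> // x x0; first exact: iter_ge0.
by rewrite /= /iterated; elim: d => //= i; apply: le_trans; apply: T_contr; exact: iter_ge0.
Qed.

Local Notation F := (fixed_space iterated_pc).

Fact restriction_subproof (a : F) : T (val a) \in fixed_pred iterated.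
Proof.
by rewrite unfold_in -[in X in _ == X](fixed_valE a) /= /iterated -iterS -iterSr.
Qed.
Definition restriction (a : F) : F := FixedSpace iterated_pc (restriction_subproof a).

Fact restriction_linear : linear restriction.
Proof. by move=> a x y; apply: val_inj; rewrite /= !linearP. Qed.
HB.instance Definition _ :=
  GRing.isLinear.Build R F F *:%R restriction restriction_linear.

Lemma val_iter_restriction i (a : F) : val (iter i restriction a) = iter i T (val a).
Proof. by elim: i => //= i <-. Qed.

Lemma periodic_free_orbits (l : R[i]) n (X Y : 'I_n -> E) : d.-primitive_root l ->
  (forall i, T (X i) = complex.Re l *: X i - complex.Im l *: Y i) ->
  (forall i, T (Y i) = complex.Re l *: Y i + complex.Im l *: X i) ->
  (forall c : 'I_n -> R[i],
    \sum_i (complex.Re (c i) *: X i - complex.Im (c i) *: Y i) = 0 ->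
    \sum_i (complex.Re (c i) *: Y i + complex.Im (c i) *: X i) = 0 ->
    forall i, c i = 0) ->
  exists h : 'I_n -> E, (forall i, iter d T (h i) = h i) /\
    forall c : 'I_n -> 'I_d -> R,
      \sum_i \sum_j c i j *: iter j T (h i) = 0 -> forall i j, c i j = 0.
Proof.
move=> l_prim TX TY free.
(* The powers of [T] multiply x + i y by the powers of [l]; at exponent [d] this factor is 1, so
   both parts lie in the fixed space. *)
have eigen_fixed (x y : E) : T x = complex.Re l *: x - complex.Im l *: y ->
    T y = complex.Re l *: y + complex.Im l *: x ->
    x \in fixed_pred iterated /\ y \in fixed_pred iterated.
  move=> Tx Ty; have iterE k :
      iter k T x = complex.Re (l ^+ k) *: x - complex.Im (l ^+ k) *: y /\
      iter k T y = complex.Re (l ^+ k) *: y + complex.Im (l ^+ k) *: x.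
    elim: k => [|k [IHx IHy]]; first by rewrite expr0 /= !scale1r !scale0r subr0 addr0.
    rewrite !iterS.
    rewrite IHx IHy linearB linearD !linearZ /= Tx Ty exprS.
    case: (l) (l ^+ k) => [a b] [a' b'] /=.
    rewrite !(scalerN, scalerDr) !scalerA ![a' * _]mulrC ![b' * _]mulrC.
    rewrite !(scalerBl, scalerDl) !opprD !addrA; split.
      by rewrite [RHS]addrAC [X in _ = X - _]addrAC [RHS]addrAC.
    by rewrite [LHS]addrAC [X in X + _ = _]addrAC [LHS]addrAC.
  have [] := iterE d; rewrite (prim_expr_order l_prim) /= !scale1r !scale0r.
  by rewrite subr0 addr0 !unfold_in /= /iterated => -> ->.
have FX i : X i \in fixed_pred iterated by case: (eigen_fixed _ _ (TX i) (TY i)).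
have FY i : Y i \in fixed_pred iterated by case: (eigen_fixed _ _ (TX i) (TY i)).
pose X' i : F := FixedSpace iterated_pc (FX i).
pose Y' i : F := FixedSpace iterated_pc (FY i).
have per (a : F) : iter d restriction a = a.
  by apply: val_inj; rewrite val_iter_restriction -[RHS]fixed_valE.
have res_ge0 (a : F) : 0 <=v a -> 0 <=v restriction a by exact: T_ge0.
have [|||h hf] := @free_wandering_family R F restriction d d_gt0 res_ge0 per
  l n X' Y' l_prim.
- by move=> i; apply: val_inj; rewrite fixed_valB !fixed_valZ; exact: TX.
- by move=> i; apply: val_inj; rewrite fixed_valD !fixed_valZ; exact: TY.
- move=> c re0 im0; apply: free.
    apply: etrans (congr1 val re0); rewrite fixed_val_sum.
    by apply: eq_bigr => i _; rewrite fixed_valB !fixed_valZ.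
  apply: etrans (congr1 val im0); rewrite fixed_val_sum.
  by apply: eq_bigr => i _; rewrite fixed_valD !fixed_valZ.
exists (fun i => val (h i)); split => [i|c c0].
  by rewrite -[RHS]fixed_valE.
apply: (wandering_family_free d_gt0 res_ge0 per hf).
apply: val_inj; rewrite fixed_val_sum; under eq_bigr => i _.
  rewrite fixed_val_sum; under eq_bigr do rewrite fixed_valZ val_iter_restriction.
  over.
exact: c0.
Qed.

End PeriodicRestriction.

(** * Complexification and dimension *)

Section RealPart.
Context {R : realType} {E : banachLatticeType R}.
Local Notation EC := (complexification E).

Definition of_real (x : E) : EC := (x, 0).

Lemma scaleECE (c : R[i]) (z : EC) : c *: z =
  (complex.Re c *: z.1 - complex.Im c *: z.2,
   complex.Re c *: z.2 + complex.Im c *: z.1).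
Proof. by []. Qed.

Lemma addECE (z w : EC) : z + w = (z.1 + w.1, z.2 + w.2).
Proof. by []. Qed.

Lemma scale_of_real c (x : E) :
  c *: of_real x = (complex.Re c *: x, complex.Im c *: x).
Proof. by rewrite scaleECE /= !scaler0 subr0 add0r. Qed.

Lemma sumEC1 (I : Type) (r : seq I) (P : pred I) (F : I -> EC) :
  (\sum_(i <- r | P i) F i).1 = \sum_(i <- r | P i) (F i).1.
Proof. by apply: (big_morph (fun z : EC => z.1)). Qed.

Lemma sumEC2 (I : Type) (r : seq I) (P : pred I) (F : I -> EC) :
  (\sum_(i <- r | P i) F i).2 = \sum_(i <- r | P i) (F i).2.
Proof. by apply: (big_morph (fun z : EC => z.2)). Qed.

(** The family defining the modulus reduces to the multiples [cos t *: x], whose greatest member [x]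
    is attained at [t = 0]. *)
Lemma cnorm_of_real (x : E) : 0 <=v x -> cnorm (of_real x) = `|x|.
Proof.
move=> x0; rewrite /cnorm /cmodulus; congr `|_|.
set A := (X in supremum _ X).
have sA : supremums A x.
  split=> [_ [t _ <-]|u]; last first.
    by apply; exists 0 => //=; rewrite cos0 sin0 scale0r addr0 scale1r.
  suff : cos t *: x + sin t *: 0 <=v x by [].
  by rewrite scaler0 addr0 -[leRHS]scale1r rz_leZl// cos_le1.
rewrite /supremum ifF; last by apply/negbTE/set0P; exists (cos 0 *: x + sin 0 *: 0), 0.
by apply: xget_subset1 => //; exact: is_subset1_supremums.
Qed.

Variable T : {linear EC -> EC}.
Hypothesis T_pos : positive_operator T.

Definition real_part (x : E) : E := (T (of_real x)).1.

Lemma of_realP (a : R) (x y : E) :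
  of_real (a *: x + y) = (a%:C)%C *: of_real x + of_real y.
Proof. by rewrite scale_of_real addECE /= scale0r addr0. Qed.

Fact real_part_linear : linear real_part.
Proof.
move=> a x y; rewrite /real_part of_realP linearP.
by rewrite addECE scaleECE /= scale0r subr0.
Qed.
HB.instance Definition _ :=
  GRing.isLinear.Build R E E *:%R real_part real_part_linear.

Lemma real_part_ge0 (x : E) : 0 <=v x -> 0 <=v real_part x.
Proof. by move=> x0; case: (@T_pos (of_real x)) => //; split. Qed.

(** Positivity gives a real image on positive elements, and [x] is a difference of two such. *)
Lemma T_of_real x : T (of_real x) = of_real (real_part x).
Proof.
have im0 (y : E) : 0 <=v y -> (T (of_real y)).2 = 0.
  by move=> y0; case: (@T_pos (of_real y)) => //; split.
suff e : (T (of_real x)).2 = 0 by rewrite [LHS]surjective_pairing e.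
have -> : of_real x = of_real (rpos x) - of_real (rpos (- x)).
  by apply: (f_equal2 pair) => /=; rewrite ?rposB ?subr0.
rewrite linearB addECE /= im0; last exact: rpos_ge0.
by rewrite add0r im0 ?oppr0//; exact: rpos_ge0.
Qed.

Lemma T_real_part z : T z = (real_part z.1, real_part z.2).
Proof.
have zE : z = of_real z.1 + Complex 0 1 *: of_real z.2.
  rewrite scale_of_real addECE /= scale0r scale1r add0r addr0.
  by case: z.
rewrite [in LHS]zE linearD linearZ /= !T_of_real !scale_of_real addECE /=.
by rewrite !scale0r !scale1r !addr0 !add0r.
Qed.

Lemma real_part_contr : contractive T ->
  forall x : E, 0 <=v x -> `|real_part x| <= `|x|.
Proof.
move=> contr x x0; rewrite -!cnorm_of_real//; last exact: real_part_ge0.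
by rewrite -T_of_real.
Qed.

End RealPart.

(** * Comparing dimensions through finite free families *)

Section Dimension.
Context {R : realType} {V : lmodType R[i]}.
Implicit Types (W : set V).

Definition free_family n (v : 'I_n -> V) :=
  forall c : 'I_n -> R[i], \sum_i c i *: v i = 0 -> forall i, c i = 0.

Lemma free_family_le_basis W n N (v : 'I_n -> V) (b : 'I_N -> V) :
  is_basis W b -> (forall i, W (v i)) -> free_family v -> (n <= N)%N.
Proof.
move=> [_ _ span] Wv free; rewrite leqNgt; apply/negP => Nn.
pose a i := sval (cid (span _ (Wv i))).
have aP i : v i = \sum_j a i j *: b j by rewrite /a; case: cid.
pose M : 'M[R[i]]_(n, N) := \matrix_(i, j) a i j.
have kM : nz_row (kermx M) != 0.
  rewrite nz_row_eq0 -mxrank_eq0 mxrank_ker subn_eq0 -ltnNge.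
  exact: leq_ltn_trans (rank_leq_col M) Nn.
have /rV0Pn[i /eqP] := kM; apply.
apply: (free (fun i => nz_row (kermx M) 0 i)).
under eq_bigr do rewrite aP scaler_sumr.
rewrite exchange_big big1// => j _.
under eq_bigr do rewrite scalerA.
rewrite -scaler_suml [X in X *: _](_ : _ = 0) ?scale0r//.
have /sub_kermxP/matrixP/(_ 0 j) := nz_row_sub (kermx M).
by rewrite !mxE => {2}<-; apply: eq_bigr => k _; rewrite !mxE.
Qed.

Lemma maximal_free_family_basis W n (v : 'I_n -> V) :
  (forall i, W (v i)) -> free_family v ->
  (forall w : 'I_n.+1 -> V, (forall i, W (w i)) -> ~ free_family w) ->
  is_basis W v.
Proof.
move=> Wv free max; split => // w Ww.
pose v' (i : 'I_n.+1) := oapp v w (unlift ord_max i).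
have v'max : v' ord_max = w by rewrite /v' unlift_none.
have v'lift i : v' (widen_ord (leqnSn n) i) = v i.
  rewrite /v' (_ : widen_ord _ i = lift ord_max i) ?liftK//.
  by apply: val_inj; rewrite /= /bump leqNgt ltn_ord.
apply: contrapT => nospan; apply: (max v').
  by move=> i; rewrite /v'; case: unlift.
move=> c; rewrite big_ord_recr /= v'max.
under eq_bigr do rewrite v'lift.
move=> c0; have cmax : c ord_max = 0.
  apply/eqP; apply: contrapT => /negP cn0; apply: nospan.
  exists (fun i => - (c ord_max)^-1 * c (widen_ord (leqnSn n) i)).
  under eq_bigr do rewrite -scalerA.
  rewrite -scaler_sumr scaleNr; move/eqP: c0; rewrite addr_eq0 => /eqP ->.
  by rewrite scalerN opprK scalerA mulVf// scale1r.
move: c0; rewrite cmax scale0r addr0 => /free cw i.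
case: (unliftP ord_max i) => [j ->|-> //].
rewrite (_ : lift ord_max j = widen_ord (leqnSn n) j) ?cw//.
by apply: val_inj; rewrite /= /bump leqNgt ltn_ord.
Qed.

(** If [W2] has a basis of length [N], no free family in [W1] is longer than [N], so a longest one
    exists and is a basis. Otherwise the right side is the default [+oo]. *)
Lemma dimension_le W1 W2 :
  (forall n (v : 'I_n -> V), (forall i, W1 (v i)) -> free_family v ->
    exists2 w : 'I_n -> V, (forall i, W2 (w i)) & free_family w) ->
  (dimension W1 <= dimension W2)%E.
Proof.
move=> sub; rewrite [leRHS]/dimension; case: xgetP => [_ ->|_]; last first.
  by rewrite leey.
move=> [N [b bP] <-].
have bound n (v : 'I_n -> V) : (forall i, W1 (v i)) -> free_family v -> (n <= N)%N.
  by move=> W1v /(sub _ _ W1v)[w W2w]; exact: free_family_le_basis bP W2w.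
have [n [v vP]] : exists n (v : 'I_n -> V), is_basis W1 v.
  apply: contrapT => nb.
  have fam n : exists v : 'I_n -> V, (forall i, W1 (v i)) /\ free_family v.
    elim: n => [|n [v [W1v fv]]].
      have v0 : 'I_0 -> V by case.
      by exists v0; split => [[]|c _ []].
    apply: contrapT => no; apply: nb; exists n, v.
    by apply: maximal_free_family_basis => // w W1w fw; apply: no; exists w.
  have [v [W1v fv]] := fam N.+1.
  by have := bound _ _ W1v fv; rewrite ltnn.
(* The basis picked by [xget] may have another length [m], but the bound [N] applies to it as
   well. *)
rewrite /dimension; case: xgetP => [_ ->|/(_ n%:R%:E)]; last first.
  by case; exists n => //; exists v.
move=> [m [u [W1u fu _]] <-]; rewrite lee_fin ler_nat.
exact: bound W1u fu.
Qed.

End Dimension.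

Lemma sum_ord_shift (U : zmodType) d (f : nat -> U) : f d = f 0%N ->
  \sum_(i < d) f i.+1 = \sum_(i < d) f i.
Proof.
move=> fd; apply: (addrI (f 0%N)).
have := @big_ord_recl U 0 +%R d (fun i => f i).
by rewrite big_ord_recr /= fd => <-; rewrite addrC.
Qed.

(** * Eigenvectors for the powers of a root of unity *)

Section Powers.
Context {R : realType} {E : banachLatticeType R}.
Local Notation EC := (complexification E).
Variable T : {linear EC -> EC}.
Hypotheses (E_mono : monotonically_complete E) (E_fatou : fatou_property E).
Hypotheses (T_pos : positive_operator T) (T_contr : contractive T).

Lemma ker_subP (l : R[i]) (z : EC) : ker_sub l T z <-> T z = l *: z.
Proof.
rewrite /ker_sub /=; split => [/eqP|->]; last exact: subrr.
by rewrite subr_eq0 => /eqP.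
Qed.

Lemma free_family_power (l : R[i]) d (k : int) n (v : 'I_n -> EC) :
  d.-primitive_root l ->
  (forall i, ker_sub l T (v i)) -> free_family v ->
  exists2 w : 'I_n -> EC, (forall i, ker_sub (l ^ k) T (w i)) & free_family w.
Proof.
move=> l_prim kv fv; have d_gt0 := prim_order_gt0 l_prim.
have ld := prim_expr_order l_prim.
have eigen i : T (v i) = l *: v i by exact/ker_subP.
have [|||h [hper hfree]] := @periodic_free_orbits R E (real_part T) E_mono E_fatou
    (real_part_ge0 T_pos) (real_part_contr T_pos T_contr) d d_gt0 l n
    (fun i => (v i).1) (fun i => (v i).2) l_prim.
- by move=> i; have := eigen i; rewrite (T_real_part T_pos) => /(congr1 fst).
- by move=> i; have := eigen i; rewrite (T_real_part T_pos) => /(congr1 snd).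
- move=> c c1 c2; apply: fv; rewrite [LHS]surjective_pairing sumEC1 sumEC2.
  by apply: (f_equal2 pair).
set m := l ^ k; have md : m ^+ d = 1.
  by rewrite /m exprnP exprz_exp mulrC -exprz_exp -exprnP ld exp1rz.
have m0 : m != 0.
  by apply: contra_eq_neq md => ->; rewrite expr0n gtn_eqF// eq_sym oner_eq0.
pose t j i : EC := m^-1 ^+ i *: of_real (iter i (real_part T) (h j)).
exists (fun j => \sum_(i < d) t j i) => [j|c c0 j].
  apply/ker_subP; rewrite linear_sum.
  (* [T] sends the term of index [i] to [m] times that of index [i + 1]. The term of index [d]
     equals that of index [0], by [m ^+ d = 1] and periodicity of [h j], so the sum may be
     shifted. *)
  rewrite -(@sum_ord_shift _ d (t j)); last first.
    by rewrite /t hper expr0 exprVn md invr1.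
  rewrite scaler_sumr; apply: eq_bigr => i _.
  rewrite /t linearZ /= (T_of_real T_pos) scalerA exprS mulrA divff// mul1r.
  by [].
have sum0 : \sum_j \sum_(i < d) (c j * m^-1 ^+ i) *: of_real (iter i (real_part T) (h j)) = 0.
  rewrite -[RHS]c0; apply: eq_bigr => j' _; rewrite scaler_sumr.
  by apply: eq_bigr => i _; rewrite scalerA.
(* At index [0] the factor is [m^-1 ^+ 0 = 1], so freeness of the orbits over the reals yields the
   real and imaginary parts of [c j] themselves. *)
pose i0 : 'I_d := Ordinal d_gt0.
have re0 : complex.Re (c j) = 0.
  have := hfree (fun j i => complex.Re (c j * m^-1 ^+ i)) _ j i0.
  rewrite expr0 mulr1; apply.
  apply: etrans (congr1 fst sum0); rewrite sumEC1; apply: eq_bigr => j' _.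
  by rewrite sumEC1; apply: eq_bigr => i _; rewrite scale_of_real.
have im0 : complex.Im (c j) = 0.
  have := hfree (fun j i => complex.Im (c j * m^-1 ^+ i)) _ j i0.
  rewrite expr0 mulr1; apply.
  apply: etrans (congr1 snd sum0); rewrite sumEC2; apply: eq_bigr => j' _.
  by rewrite sumEC2; apply: eq_bigr => i _; rewrite scale_of_real.
by case: (c j) re0 im0 => a b /= -> ->.
Qed.

End Powers.

Theorem corollary3p3 (R : realType) (E : banachLatticeType R)
    (E_mono : monotonically_complete E) (E_fatou : fatou_property E)
    (T : {linear complexification E -> complexification E})
    (T_pos : positive_operator T) (T_contr : contractive T)
    (lambda : R[i])
    (lambda_root : exists2 n : nat, (0 < n)%N & n.-unity_root lambda)
    (lambda_eigen : is_eigenvalue T lambda) :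
  forall k : int,
    is_eigenvalue T (lambda ^ k) /\
    (dimension (ker_sub lambda T) <= dimension (ker_sub (lambda ^ k) T))%E.
Proof.
move=> k; case: lambda_root => n n_gt0 /unity_rootP ln.
have [d d_prim _] := prim_order_exists n_gt0 ln.
have power m (v : 'I_m -> complexification E) :=
  free_family_power E_mono E_fatou T_pos T_contr (v := v) k d_prim.
split; last by apply: dimension_le => m v; exact: power.
(* A non-zero eigenvector is a free family of length one, so [power] also gives the eigenvalue
   claim. *)
case: lambda_eigen => z z0 Tz.
have [||w kw fw] := power 1%N (fun=> z).
- by move=> _; apply/ker_subP.
- move=> c; rewrite big_ord1 => /eqP; rewrite scaler_eq0 (negbTE z0) orbF.
  by move=> /eqP c0 i; rewrite ord1.
exists (w ord0); last exact/ker_subP.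
apply/eqP => w0; have := fw (fun=> 1).
by rewrite big_ord1 w0 scaler0 => /(_ erefl ord0)/eqP; rewrite oner_eq0.
Qed.
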